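(* Let $n \ge 3$ and let $\mathcal Z : \mathrm{Conv}(\mathbb R^n;\mathbb R) \to F(\mathbb R^n;\mathbb R)$ be a map. Then $\mathcal Z$ is a continuous and $\mathrm{SL}(n)$ covariant valuation which is a translation homomorphism if and only if there is a constant $c \in \mathbb R$ such that $$\mathcal Z u = u + c$$ for every $u \in \mathrm{Conv}(\mathbb R^n;\mathbb R)$.
   Context: $\mathrm{Conv}(\mathbb R^n;\mathbb R)$ is the set of all finite convex functions $u:\mathbb R^n\to\mathbb R$. $F(\mathbb R^n;\mathbb R)$ is the set of all functions $\mathbb R^n\to\mathbb R$. $u\vee v$ and $u\wedge v$ denote pointwise maximum and minimum. $\mathcal Z$ is a valuation if $\mathcal Z(u\vee v)+\mathcal Z(u\wedge v)=\mathcal Z u+\mathcal Z v$ whenever $u,v,u\vee v,u\wedge v\in \mathrm{Conv}(\mathbb R^n;\mathbb R)$. $\mathcal Z$ is continuous if epi-convergence $u_i\to u$ in $\mathrm{Conv}(\mathbb R^n;\mathbb R)$ implies $\mathcal Z u_i\to\mathcal Z u$ pointwise. Epi-convergence $u_i\to u$ means: for every $x\in\mathbb R^n$, $u(x)\le\liminf_i u_i(x_i)$ for all $x_i\to x$, and there is a sequence $x_i\to x$ with $u(x)=\lim_i u_i(x_i)$. $\mathcal Z$ is $\mathrm{SL}(n)$ covariant if $\mathcal Z(u\circ\phi^{-1})=(\mathcal Z u)\circ\phi^{-1}$ for all $u$ and all $\phi\in \mathrm{SL}(n)$. For $y\in\mathbb R^n$ write $\tau_y f(x)=f(x-y)$ and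 $\ell_y(x)=x\cdot y$. $\mathcal Z$ is a translation homomorphism if $\mathcal Z(\tau_y u)=\tau_y\mathcal Z(u)$ and $\mathcal Z(u+\ell_y)=\mathcal Z(u)+\ell_y$ for all $u\in \mathrm{Conv}(\mathbb R^n;\mathbb R)$ and $y\in\mathbb R^n$. *)

(* Defs.v *)
From HB Require Import structures.
From mathcomp Require Import all_boot all_order all_algebra.
From mathcomp Require Import all_classical all_reals all_analysis.

Set Implicit Arguments.
Unset Strict Implicit.
Unset Printing Implicit Defensive.

Import Order.TTheory GRing.Theory Num.Theory.
Import numFieldNormedType.Exports.

Local Open Scope classical_set_scope.
Local Open Scope ring_scope.

Section ConvexFunctions.
Context (R : realType) (n : nat).

Record Conv := MkConv {
  Conv_fun :> 'cV[R]_n -> R ;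
  Conv_convex :
    convex_function [set: convex_lmodType 'cV[R]_n] Conv_fun }.

Definition dot (x y : 'cV[R]_n) : R := \sum_(i < n) x i 0 * y i 0.

Definition translate (y : 'cV[R]_n) (f : 'cV[R]_n -> R) : 'cV[R]_n -> R :=
  fun x => f (x - y).

Definition ell (y : 'cV[R]_n) : 'cV[R]_n -> R := fun x => dot x y.

Definition precomp (A : 'M[R]_n) (f : 'cV[R]_n -> R) : 'cV[R]_n -> R :=
  fun x => f (A *m x).

Fact translate_convex y (u : Conv) :
  convex_function [set: convex_lmodType 'cV[R]_n] (translate y u).
Proof.
move=> t a b _ _; rewrite /translate.
have -> : (conv t a b : 'cV[R]_n) - y =
    conv t (a - y : convex_lmodType 'cV[R]_n) (b - y).
  rewrite /conv /= !scalerBr addrACA -opprD -scalerDl.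
  by rewrite [X in X *: y]addrC subrK scale1r.
by apply: Conv_convex; rewrite inE.
Qed.

Fact add_ell_convex y (u : Conv) :
  convex_function [set: convex_lmodType 'cV[R]_n] (u \+ ell y).
Proof.
move=> t a b _ _ /=.
have ellE : ell y (conv t a b) = conv t (ell y a : R^o) (ell y b).
  rewrite /ell /dot convRE !mulr_sumr -big_split /=.
  by apply: eq_bigr => i _; rewrite !mxE mulrDl !mulrA.
rewrite ellE !convRE !mulrDr addrACA lerD2r.
by apply: Conv_convex; rewrite inE.
Qed.

Fact precomp_convex A (u : Conv) :
  convex_function [set: convex_lmodType 'cV[R]_n] (precomp A u).
Proof.
move=> t a b _ _; rewrite /precomp.
have -> : A *m (conv t a b : 'cV[R]_n) =
    conv t (A *m a : convex_lmodType 'cV[R]_n) (A *m b).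
  by rewrite /conv /= mulmxDr -!scalemxAr.
by apply: Conv_convex; rewrite inE.
Qed.

Definition Conv_translate y (u : Conv) : Conv := MkConv (translate_convex y u).
Definition Conv_add_ell y (u : Conv) : Conv := MkConv (add_ell_convex y u).
Definition Conv_precomp A (u : Conv) : Conv := MkConv (precomp_convex A u).

Definition epi_cvg (u_ : nat -> Conv) (u : Conv) : Prop :=
  forall x : 'cV[R]_n,
    (forall x_ : nat -> 'cV[R]_n, x_ @ \oo --> x ->
       ((u x)%:E <= limn_einf (fun i => (u_ i (x_ i))%:E))%E) /\
    (exists2 x_ : nat -> 'cV[R]_n,
       x_ @ \oo --> x & (fun i => u_ i (x_ i)) @ \oo --> u x).

Implicit Type Z : Conv -> 'cV[R]_n -> R.

(* The pointwise minimum of convex functions need not be convex: [m] and [w]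
   range over the elements of [Conv] that happen to be the minimum and the
   maximum of [u] and [v]. *)
Definition is_valuation Z : Prop :=
  forall u v w m : Conv,
    w = u \max v :> ('cV[R]_n -> R) ->
    m = u \min v :> ('cV[R]_n -> R) ->
    Z w \+ Z m = Z u \+ Z v.

Definition epi_continuous Z : Prop :=
  forall (u_ : nat -> Conv) (u : Conv), epi_cvg u_ u ->
    forall x : 'cV[R]_n, (fun i => Z (u_ i) x) @ \oo --> Z u x.

Definition SL_covariant Z : Prop :=
  forall (u : Conv) (phi : 'M[R]_n), \det phi = 1 ->
    Z (Conv_precomp (invmx phi) u) = precomp (invmx phi) (Z u).

Definition translation_homomorphism Z : Prop :=
  forall (u : Conv) (y : 'cV[R]_n),
    Z (Conv_translate y u) = translate y (Z u) /\
    Z (Conv_add_ell y u) = Z u \+ ell y.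

End ConvexFunctions.

(* Main.v *)
Require Import Defs.
From mathcomp Require Import all_boot all_order all_algebra.
From mathcomp Require Import all_classical all_reals all_analysis.
From mathcomp Require Import perm ring lra.
Set Implicit Arguments.
Unset Strict Implicit.
Unset Printing Implicit Defensive.
Import Order.TTheory GRing.Theory Num.Theory.
Import numFieldNormedType.Exports.
Local Open Scope classical_set_scope.
Local Open Scope ring_scope.

(** Everything is about the real functional W u = Z u 0 - u 0.  Because Z
    commutes with translations and with the addition of linear functions, W
    ignores the addition of affine functions (translation_const), and Z is
    recovered from its values at the origin.  W is moreover a continuous
    valuation, invariant under SL(n).  The claim is that such a W, normalized
    to vanish at affine functions, is zero.

    A function whose slopes span fewer than n dimensions can be squeezed to a
    constant by a one-parameter family in SL(n), so W vanishes there
    (Wfam_rank).  Next consider a maximum of n + 1 affine functions, with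
    slopes the rows of P and constants c, and insert on the segment between
    two of them an intermediate affine function.  The valuation property
    splits the maximum into two maxima of the same kind
    (Wfam_split_simplex); dually, a simplex is cut by a hyperplane.  If two
    constants agree, this is Cauchy's functional equation in the volume of the
    simplex of slopes, and since among three constants one always lies between
    the other two, W (max) = |vol P| * density c for all c (Wfam_linear).

    The density satisfies an averaging identity under splitting, so it obeys a
    maximum principle: from a maximum point over a cube one can move
    every constant to the value of the first one without leaving the set of
    maximum points (contract_max).  Both extrema are then attained at constant
    vectors, where the density has a single value by invariance, so the
    density is constant (density_const).  Sending one constant to minus
    infinity removes one affine function from the maximum while the volume
    stays 1, so the constant is zero (density0).

    More than n + 1 affine functions reduce to fewer.  Their slopes are
    affinely dependent, which gives a subfamily J with a convex combination
    lying below the maximum of the other functions; then the alternating sum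
    of W over the maxima with subfamilies of J vanishes (Delta_eq0), and all
    its terms except one involve fewer functions (vanishes_step).  Finally,
    every finite convex function is a locally uniform limit of maxima of
    finitely many of its supporting affine functions (approx_affine).

    In the converse direction the only point is that epi-convergence of
    finite convex functions implies pointwise convergence
    (epi_cvg_pointwise). *)

(** * Linear forms and subgradients *)

Section Pairing.
Context (R : realType) (n : nat).
Implicit Types (p q : 'rV[R]_n) (x y : 'cV[R]_n).

Definition lform p x : R := (p *m x) 0 0.

Lemma lformDl p q x : lform (p + q) x = lform p x + lform q x.
Proof. by rewrite /lform mulmxDl mxE. Qed.
Lemma lformZl t p x : lform (t *: p) x = t * lform p x.
Proof. by rewrite /lform -scalemxAl mxE. Qed.
Lemma lformDr p x y : lform p (x + y) = lform p x + lform p y.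
Proof. by rewrite /lform mulmxDr mxE. Qed.
Lemma lformZr t p x : lform p (t *: x) = t * lform p x.
Proof. by rewrite /lform -scalemxAr mxE. Qed.
Lemma lformNr p x : lform p (- x) = - lform p x.
Proof. by rewrite -scaleN1r lformZr mulN1r. Qed.
Lemma lformBr p x y : lform p (x - y) = lform p x - lform p y.
Proof. by rewrite lformDr lformNr. Qed.
Lemma lform0l x : lform 0 x = 0.
Proof. by rewrite /lform mul0mx mxE. Qed.
Lemma lform0r p : lform p 0 = 0.
Proof. by rewrite /lform mulmx0 mxE. Qed.
Lemma lformE p x : lform p x = \sum_i p 0 i * x i 0.
Proof. by rewrite /lform mxE. Qed.
Lemma lform_delta p i : lform p (delta_mx i 0) = p 0 i.
Proof. by rewrite /lform -colE mxE. Qed.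
Lemma ellE p x : ell p^T x = lform p x.
Proof. by rewrite /ell /dot lformE; apply: eq_bigr => i _; rewrite mxE mulrC. Qed.

Lemma coord_cvg (x_ : nat -> 'cV[R]_n) x i :
  x_ @ \oo --> x -> (fun k => x_ k i 0) @ \oo --> x i 0.
Proof. by move=> cx; apply: (continuous_cvg _ (@coord_continuous R n 1 i 0 x)). Qed.

Lemma lform_cvg (p_ : nat -> 'rV[R]_n) p (x_ : nat -> 'cV[R]_n) x :
  (forall i, (fun k => p_ k 0 i) @ \oo --> p 0 i) ->
  x_ @ \oo --> x -> (fun k => lform (p_ k) (x_ k)) @ \oo --> lform p x.
Proof.
move=> cp cx; rewrite lformE.
rewrite [X in X @ _ --> _](_ : _ = fun k => \sum_i p_ k 0 i * x_ k i 0).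
  by apply: (cvg_big add_continuous) => i _; apply: cvgM; [exact: cp|exact: coord_cvg].
by apply/funext => k; rewrite lformE.
Qed.

End Pairing.

Section ConvBasics.
Context (R : realType) (n : nat).
Implicit Types (u v : Conv R n) (p : 'rV[R]_n) (x y : 'cV[R]_n).

Lemma Conv_ext u v : u =1 v -> u = v.
Proof.
case: u v => [f cf] [g cg] /= /funext fg; subst g.
by congr MkConv; exact: Prop_irrelevance.
Qed.

Lemma ConvP u (t : R) x y : 0 <= t <= 1 ->
  u (t *: x + (1 - t) *: y) <= t * u x + (1 - t) * u y.
Proof.
move=> /andP[t0 t1].
by have := @Conv_convex _ _ u (Itv01 t0 t1) x y; apply; rewrite inE.
Qed.

Lemma convex_functionT (f : 'cV[R]_n -> R) :
  (forall (t : R) x y, 0 <= t <= 1 ->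
     f (t *: x + (1 - t) *: y) <= t * f x + (1 - t) * f y) ->
  convex_function [set: convex_lmodType 'cV[R]_n] f.
Proof. by move=> cf t x y _ _; apply: cf; rewrite ge0 le1. Qed.

(** Convexity with positive weights that are not normalized, the form in which
    it compares one-sided difference quotients. *)
Lemma ConvP_weights u (a b : R) x y : 0 < a -> 0 < b ->
  (a + b) * u ((a + b)^-1 *: (a *: x + b *: y)) <= a * u x + b * u y.
Proof.
move=> a0 b0; have ab0 : 0 < a + b by rewrite addr_gt0.
have t01 : 0 <= a / (a + b) <= 1.
  by apply/andP; split; rewrite ?divr_ge0 ?ler_pdivrMr ?mul1r ?lerDl// ltW.
have -> : (a + b)^-1 *: (a *: x + b *: y) =
          (a / (a + b)) *: x + (1 - a / (a + b)) *: y.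
  by rewrite scalerDr !scalerA; congr (_ *: _ + _ *: _); field; lra.
have := ler_wpM2l (ltW ab0) (ConvP u x y t01).
move/le_trans; apply; rewrite le_eqVlt; apply/orP; left; apply/eqP.
by field; lra.
Qed.

(** Hahn-Banach in coordinates: a linear form supporting u at x0 along the
    span of the first k coordinate vectors extends to one more coordinate e,
    because, by convexity, every backward difference quotient of u - p along e
    is at most every forward one; the new slope is the supremum of the
    backward ones. *)
Lemma subgradient_coords u x0 (k : nat) : (k <= n)%N ->
  exists p, forall y, (forall i : 'I_n, (k <= i)%N -> y i 0 = 0) ->
    u x0 + lform p y <= u (x0 + y).
Proof.
elim: k => [_|k IH kn].
  exists 0 => y y0; have -> : y = 0.
    by apply/matrixP => i j; rewrite ord1 y0 // mxE.
  by rewrite addr0 lform0l addr0.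
have [p hp] := IH (ltnW kn); pose i0 := Ordinal kn.
pose e : 'cV[R]_n := delta_mx i0 0.
pose flat y := forall i : 'I_n, (k <= i)%N -> y i 0 = 0.
pose S := [set s : R | exists y r, [/\ flat y, 0 < r &
  s = (u x0 + lform p y - u (x0 + y - r *: e)) / r]].
have ubS y t : flat y -> 0 < t ->
    ubound S ((u (x0 + y + t *: e) - u x0 - lform p y) / t).
  move=> fy t0 _ [z [r [fz r0 ->]]].
  rewrite ler_pdivrMr // mulrAC ler_pdivlMr //.
  have tr0 : 0 < t + r by rewrite addr_gt0.
  have := ConvP_weights u (x0 + z - r *: e) (x0 + y + t *: e) t0 r0.
  have -> : (t + r)^-1 *: (t *: (x0 + z - r *: e) + r *: (x0 + y + t *: e)) =
      x0 + (t + r)^-1 *: (t *: z + r *: y).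
    rewrite -[in RHS](scale1r x0) -[in RHS](mulVf (lt0r_neq0 tr0)) -scalerA.
    rewrite -scalerDr; congr (_ *: _).
    rewrite !scalerDr scalerDl scalerN !scalerA [r * t]mulrC.
    by apply/matrixP => i j; rewrite !mxE; ring.
  have fzy : flat ((t + r)^-1 *: (t *: z + r *: y)).
    by move=> i ki; rewrite !mxE (fz _ ki) (fy _ ki) !mulr0 addr0 mulr0.
  have := hp _ fzy; rewrite lformZr lformDr !lformZr.
  move: (u (_ + (t + r)^-1 *: _)) => m hm.
  have {}hm := ler_wpM2l (ltW tr0) hm.
  rewrite mulrDr mulrA divff ?lt0r_neq0// mul1r in hm.
  by move=> /(le_trans hm) h; lra.
have flat0 : flat 0 by move=> i _; rewrite mxE.
have S0 : S !=set0 by eexists; exists 0, 1; split.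
have supS : has_sup S by split => //; eexists; exact: (ubS 0 1).
(* changes the slope along e from p 0 i0 to sup S *)
exists (p + (sup S - p 0 i0) *: e^T) => z fz.
pose t := z i0 0; pose y := z - t *: e.
have fy : flat y.
  move=> i ki; rewrite /y !mxE andbT; have [->|ne] := eqVneq i i0.
    by rewrite /t mulr1 subrr.
  rewrite mulr0 subr0; apply: fz; rewrite ltn_neqAle ki andbT.
  by apply: contraNneq ne => ki'; apply/eqP/val_inj.
have zE : z = y + t *: e by rewrite /y subrK.
have -> : lform (p + (sup S - p 0 i0) *: e^T) z = lform p y + t * sup S.
  rewrite lformDl lformZl {1}zE lformDr lformZr lform_delta.
  have -> : lform e^T z = t.
    by rewrite /lform trmx_delta -rowE mxE.
  by ring.
have [t0|t0|t0] := ltgtP t 0.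
- have : S ((u x0 + lform p y - u (x0 + y - (- t) *: e)) / - t).
    by exists y, (- t); split => //; rewrite oppr_gt0.
  move/(sup_upper_bound supS); rewrite ler_pdivrMr ?oppr_gt0//.
  by rewrite scaleNr opprK -(addrA x0) -zE; lra.
- have := @ge_sup _ S _ S0 (ubS y t fy t0).
  by rewrite ler_pdivlMr// -(addrA x0) -zE; lra.
- by rewrite t0 mul0r addr0 zE t0 scale0r addr0; apply: hp.
Qed.

Lemma subgradient u x0 : exists p, forall x, u x0 + lform p (x - x0) <= u x.
Proof.
have [p hp] := subgradient_coords u x0 (leqnn n).
exists p => x; have := hp (x - x0); rewrite addrCA subrr addr0; apply.
by move=> i; rewrite leqNgt ltn_ord.
Qed.

End ConvBasics.

(** * Epi-convergence of finite convex functions *)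

Section EpiConvergence.
Context (R : realType) (n : nat).
Implicit Types (u v : Conv R n) (p : 'rV[R]_n) (x y : 'cV[R]_n).

(** The vertices of the cross-polytope of radius d around x; s is the sign. *)
Definition spike x (d : R) (i : 'I_n) (s : bool) : 'cV[R]_n :=
  x + ((-1) ^+ s * d) *: delta_mx i 0.

(** A point near the center of a slightly perturbed cross-polytope lies in its
    convex hull, so a convex function is at most its maximum over the vertices
    there.  The hull is avoided: the vertex is chosen along the largest
    coordinate of a subgradient at y, with the matching sign. *)
Lemma le_some_spike u x (d eta : R) (z : 'I_n -> bool -> 'cV[R]_n) y :
  (0 < n)%N -> 2 * eta * n%:R <= d ->
  (forall i s j, `|z i s j 0 - spike x d i s j 0| <= eta) ->
  (forall j, `|y j 0 - x j 0| <= eta) ->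
  exists i s, u y <= u (z i s).
Proof.
move=> n0 etad hz hy; have [p hp] := subgradient u y.
pose i := [arg max_(i > Ordinal n0) `|p 0 i|]%O.
have pmax j : `|p 0 j| <= `|p 0 i|.
  by rewrite /i; case: arg_maxP => // k _; apply.
exists i, (p 0 i < 0).
apply: le_trans (hp _); rewrite lerDl.
pose w := z i (p 0 i < 0)%R - spike x d i (p 0 i < 0)%R - (y - x).
have -> : z i (p 0 i < 0)%R - y =
    w + ((-1) ^+ (p 0 i < 0)%R * d) *: delta_mx i 0.
  by rewrite /w /spike; apply/matrixP => a b; rewrite !mxE; ring.
rewrite lformDr lformZr lform_delta mulrAC -normrEsign.
have wb j : `|w j 0| <= 2 * eta.
  rewrite /w; have := ler_normB (z i (p 0 i < 0)%R j 0 -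
    spike x d i (p 0 i < 0)%R j 0) (y j 0 - x j 0).
  rewrite !mxE => h; apply: le_trans h _.
  have := hz i (p 0 i < 0)%R j; have := hy j; rewrite !mxE; lra.
have : `|lform p w| <= `|p 0 i| * (2 * eta * n%:R).
  rewrite lformE; apply: le_trans (ler_norm_sum _ _ _) _.
  apply: (@le_trans _ _ (\sum_(j < n) `|p 0 i| * (2 * eta))).
    by apply: ler_sum => j _; rewrite normrM ler_pM.
  by rewrite sumr_const card_ord -[leLHS]mulr_natr -mulrA lexx.
rewrite ler_norml => /andP[h _].
have := ler_wpM2l (normr_ge0 (p 0 i)) etad.
rewrite -lerBlDr sub0r; lra.
Qed.

Lemma spike_le u x (eps : R) : 0 < eps ->
  exists2 d : R, 0 < d & forall i s, u (spike x d i s) <= u x + eps.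
Proof.
move=> e0.
pose K := \sum_i \sum_s `|u (spike x 1 i s) - u x|.
have K0 : 0 <= K by apply: sumr_ge0 => i _; apply: sumr_ge0.
have Ke0 : 0 < K + eps by lra.
(* any d with d <= 1 and d * K <= eps would do *)
exists (eps / (K + eps)); first by rewrite divr_gt0.
move=> i s; set d := eps / _.
have d01 : 0 <= d <= 1.
  apply/andP; split; first by rewrite divr_ge0 // ltW.
  by rewrite ler_pdivrMr// mul1r lerDr.
have -> : spike x d i s = d *: spike x 1 i s + (1 - d) *: x.
  by apply/matrixP => a b; rewrite !mxE; ring.
apply: le_trans (ConvP _ _ _ d01) _.
have hK : u (spike x 1 i s) - u x <= K.
  apply: le_trans (ler_norm _) _.
  rewrite /K (bigD1 i)//= (bigD1 s)//= -!addrA lerDl addr_ge0//.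
    by apply: sumr_ge0.
  by apply: sumr_ge0 => j _; apply: sumr_ge0.
have dK : d * K <= eps.
  rewrite /d mulrAC ler_pdivrMr// ler_wpM2l ?ltW//; lra.
have d0 : 0 <= d by case/andP: d01.
have := ler_wpM2l d0 hK; lra.
Qed.

(** Only recovery sequences are available for u_, so the values at y_ k are
    bounded by those along the recovery sequences of the vertices of a
    cross-polytope around x. *)
Lemma limsup_le (u_ : nat -> Conv R n) u x (y_ : nat -> 'cV[R]_n) (eps : R) :
  (0 < n)%N ->
  (forall z : 'cV[R]_n, exists2 z_ : nat -> 'cV[R]_n,
     z_ @ \oo --> z & (fun k => u_ k (z_ k)) @ \oo --> u z) ->
  y_ @ \oo --> x -> 0 < eps ->
  \forall k \near \oo, u_ k (y_ k) <= u x + eps.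
Proof.
move=> n0 hz yx e0.
have e20 : 0 < eps / 2 by lra.
have [d d0 hd] := spike_le u x e20.
have n0' : 0 < n%:R :> R by rewrite ltr0n.
pose eta := d / (2 * n%:R).
have eta0 : 0 < eta by rewrite divr_gt0 // mulr_gt0.
have /choice[z_ hz_] : forall a : 'I_n * bool, exists z_ : nat -> 'cV[R]_n,
    z_ @ \oo --> spike x d a.1 a.2 /\
    (fun k => u_ k (z_ k)) @ \oo --> u (spike x d a.1 a.2).
  by move=> a; have [z_ h1 h2] := hz (spike x d a.1 a.2); exists z_.
have N1 : \forall k \near \oo, forall a : 'I_n * bool, forall j : 'I_n,
    `|z_ a k j 0 - spike x d a.1 a.2 j 0| <= eta.
  apply: filter_forall => a; apply: filter_forall => j.
  by have /cvgr_distC_le := coord_cvg (i := j) (hz_ a).1; apply.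
have N2 : \forall k \near \oo, forall j : 'I_n, `|y_ k j 0 - x j 0| <= eta.
  apply: filter_forall => j.
  by have /cvgr_distC_le := coord_cvg (i := j) yx; apply.
have N3 : \forall k \near \oo, forall a : 'I_n * bool,
    u_ k (z_ a k) <= u (spike x d a.1 a.2) + eps / 2.
  apply: filter_forall => a; have /cvgr_le := (hz_ a).2; apply; lra.
near=> k.
have [i [s le_s]] : exists i s, u_ k (y_ k) <= u_ k (z_ (i, s) k).
  apply: (@le_some_spike (u_ k) x d eta (fun i s => z_ (i, s) k)) => //.
  - by rewrite /eta le_eqVlt; apply/orP; left; apply/eqP; field; lra.
  - by move=> i s; apply: (near N1 k _ (i, s)).
  - exact: (near N2 k).
apply: le_trans le_s _; apply: le_trans (near N3 k _ (i, s)) _ => //.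
have := hd i s; rewrite /=; lra.
Unshelve. all: by end_near. Qed.

(** The upper bound is limsup_le for a constant sequence of functions; the
    lower bound comes from a subgradient at x. *)
Lemma Conv_continuous u x (x_ : nat -> 'cV[R]_n) : (0 < n)%N ->
  x_ @ \oo --> x -> (fun k => u (x_ k)) @ \oo --> u x.
Proof.
move=> n0 xx; apply/cvgrPdist_le => e e0.
have hi : \forall k \near \oo, u (x_ k) <= u x + e.
  apply: (@limsup_le (fun=> u)) => // z.
  by exists (fun=> z); exact: cvg_cst.
have [p hp] := subgradient u x.
have lo : \forall k \near \oo, - e <= lform p (x_ k - x).
  have : (fun k => lform p (x_ k - x)) @ \oo --> (0 : R).
    rewrite -(lform0r p) -(subrr x); apply: (@lform_cvg _ _ (fun=> p)).
      by move=> i; exact: cvg_cst.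
    by apply: cvgB => //; exact: cvg_cst.
  by move/cvgr_ge; apply; lra.
near=> k; rewrite ler_distlC.
have h1 := near hi k _; have h2 := near lo k _.
apply/andP; split; last by apply: h1.
apply: le_trans (hp (x_ k)); rewrite lerD2l.
by apply: h2.
Unshelve. all: by end_near. Qed.

(** Continuous convergence, equivalent to locally uniform convergence for
    continuous limits.  It implies epi-convergence and is easy to verify for
    explicit families. *)
Definition locally_cvg (u_ : nat -> Conv R n) u :=
  forall (x_ : nat -> 'cV[R]_n) x, x_ @ \oo --> x ->
    (fun k => u_ k (x_ k)) @ \oo --> u x.

Lemma locally_cvg_epi (u_ : nat -> Conv R n) u : locally_cvg u_ u -> epi_cvg u_ u.
Proof.
move=> cu x; split=> [x_ xx|]; last first.
  exists (fun=> x); first exact: cvg_cst.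
  exact: (cu (fun=> x) x (cvg_cst _)).
have h : (fun k => (u_ k (x_ k))%:E) @ \oo --> (u x)%:E.
  by apply: cvg_EFin; [exact: nearW|exact: cu].
by have [-> _] := cvg_limn_einf_sup h.
Qed.

Lemma epi_cvg_pointwise (u_ : nat -> Conv R n) u x : (0 < n)%N ->
  epi_cvg u_ u -> (fun k => u_ k x) @ \oo --> u x.
Proof.
move=> n0 eu; apply/cvgrPdist_le => e e0.
have hi : \forall k \near \oo, u_ k x <= u x + e.
  by apply: (@limsup_le _ _ _ (fun=> x)) => // [z|]; [exact: (eu z).2|exact: cvg_cst].
have lo : exists m, ((u x - e)%:E < einfs (fun k => (u_ k x)%:E) m)%E.
  apply/not_existsP => h.
  have cx : (fun _ : nat => x) @ \oo --> x by exact: cvg_cst.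
  have := (eu x).1 _ cx; rewrite limn_einf_lim => h1.
  have : (limn (einfs (fun k => (u_ k x)%:E)) <= (u x - e)%:E)%E.
    apply: lime_le; first exact: is_cvg_einfs.
    by apply: nearW => m; rewrite leNgt; apply/negP/h.
  move=> /(le_trans h1); rewrite lee_fin; lra.
have [m hm] := lo.
near=> k; rewrite ler_distlC; apply/andP; split.
  rewrite -lee_fin; apply: (le_trans (ltW hm)).
  by apply: ereal_inf_lbound; exists k => //=; near: k; exists m.
by apply: (near hi k).
Unshelve. all: by end_near. Qed.

End EpiConvergence.

(** * Maxima of affine functions *)

Section MaxAffine.
Context (R : realType) (n : nat).
Implicit Types (u v : Conv R n) (p : 'rV[R]_n) (x y : 'cV[R]_n).

(** The pair (p, c) encodes the function x |-> p x + c. *)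
Definition affine : Type := ('rV[R]_n * R)%type.
Implicit Types (a b : affine) (s t : seq affine).

Definition ev a x : R := lform a.1 x + a.2.

Lemma ev_conv a (r : R) x y :
  ev a (r *: x + (1 - r) *: y) = r * ev a x + (1 - r) * ev a y.
Proof. by rewrite /ev lformDr !lformZr; ring. Qed.

Lemma ev_convex a : convex_function [set: convex_lmodType 'cV[R]_n] (ev a).
Proof. by apply: convex_functionT => r x y _; rewrite ev_conv. Qed.

Definition Conv_affine a : Conv R n := MkConv (ev_convex a).

Lemma max_convex u v :
  convex_function [set: convex_lmodType 'cV[R]_n] (u \max v).
Proof.
apply: convex_functionT => r x y /[dup] r01 /andP[r0 r1] /=.
rewrite ge_max; apply/andP; split; apply: le_trans (ConvP _ _ _ r01) _;
  by rewrite lerD// ler_wpM2l ?subr_ge0// le_max lexx ?orbT.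
Qed.

Definition Conv_max u v : Conv R n := MkConv (max_convex u v).

(** The head a is separated from the list so that the family is never empty;
    the list form makes adding one affine function a definitional step. *)
Fixpoint maxs a s : Conv R n :=
  if s is b :: s' then Conv_max (maxs a s') (Conv_affine b) else Conv_affine a.

Lemma maxs_ge a s b x : b \in a :: s -> ev b x <= maxs a s x.
Proof.
elim: s => [|c s IH]; first by rewrite inE => /eqP ->.
rewrite !inE orbCA => /predU1P[->|h] /=; first by rewrite le_max lexx orbT.
by rewrite le_max IH// inE.
Qed.

Lemma maxs_attained a s x : exists2 b, b \in a :: s & maxs a s x = ev b x.
Proof.
elim: s => [|c s [b bs IH]]; first by exists a; rewrite ?mem_head.
rewrite /= maxEle; case: ifP => _.
  by exists c => //; rewrite !inE eqxx orbT.
by exists b => //; move: bs; rewrite !inE orbCA => ->; rewrite orbT.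
Qed.

Lemma maxs_le a s x (r : R) :
  (maxs a s x <= r) = all (fun b => ev b x <= r) (a :: s).
Proof.
apply/idP/allP => [h b bs|h]; first exact: le_trans (maxs_ge x bs) h.
by have [b bs ->] := maxs_attained a s x; apply: h.
Qed.

Lemma eq_maxs a s b t : a :: s =i b :: t -> maxs a s = maxs b t.
Proof.
move=> st; apply: Conv_ext => x; apply/eqP; rewrite eq_le !maxs_le.
by apply/andP; split; apply/allP => c; [rewrite st|rewrite -st]; exact: maxs_ge.
Qed.

End MaxAffine.

Section Approximation.
Context (R : realType) (n : nat).
Implicit Types (u : Conv R n) (x y : 'cV[R]_n).

Lemma mx_cvg m k (x_ : nat -> 'M[R]_(m, k)) (x : 'M[R]_(m, k)) :
  (forall i j, (fun l => x_ l i j) @ \oo --> x i j) -> x_ @ \oo --> x.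
Proof.
move=> h; apply/cvg_ballP => e e0; near=> l; split=> //.
near: l; apply: filter_forall => i; apply: filter_forall => j.
by have /cvg_ballP := h i j; apply.
Unshelve. all: by end_near. Qed.

Definition rational_point (j : nat) : 'cV[R]_n :=
  map_mx ratr (odflt 0 (unpickle j : option 'cV[rat]_n)).

Lemma rational_point_dense x (d : R) : 0 < d ->
  exists j, forall i, `|rational_point j i 0 - x i 0| <= d.
Proof.
move=> d0.
have /choice[f hf] : forall i, exists q : rat, `|ratr q - x i 0| <= d.
  move=> i; have [|q] := @rat_in_itvoo R (x i 0 - d) (x i 0 + d); first lra.
  by rewrite in_itv/= => /andP[h1 h2]; exists q; rewrite ler_distl !ltW.
exists (pickle (\col_i f i)) => i.
by rewrite /rational_point pickleK /= !mxE.
Qed.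

(** The supporting affine functions at rational points suffice.  To see that
    they come close to u at x, take a rational q near x: the supporting
    function at q, evaluated at the reflection 2 q - x, is at most
    u (2 q - x), so at x it is at least 2 u q - u (2 q - x), which tends to
    u x without any bound on the slopes. *)
Lemma approx_affine u : (0 < n)%N ->
  exists b : nat -> affine R n,
    locally_cvg (fun k => maxs (b 0) [seq b j | j <- iota 0 k]) u.
Proof.
move=> n0.
have [P hP] := choice (subgradient u).
pose q := rational_point.
pose b j : affine R n := (P (q j), u (q j) - lform (P (q j)) (q j)).
have evb j x : ev (b j) x = u (q j) + lform (P (q j)) (x - q j).
  by rewrite /ev /b /= lformBr; ring.
have ub j x : ev (b j) x <= u x by rewrite evb.
have lb x (e : R) : 0 < e -> exists j, u x - e <= ev (b j) x.
  move=> e0.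
  have /choice[J hJ] : forall k : nat, exists j,
      forall i, `|q j i 0 - x i 0| <= (k%:R + 1)^-1.
    by move=> k; apply: rational_point_dense; rewrite invr_gt0 ltr_wpDl.
  have qx : (fun k => q (J k)) @ \oo --> x.
    apply: mx_cvg => i j; rewrite ord1.
    apply/cvgrPdist_le => d d0.
    have := @cvg_harmonic R => /cvgrPdist_le /(_ d d0) hk.
    near=> k; rewrite distrC; apply: le_trans (hJ k i) _.
    have : `|0 - harmonic k| <= d by exact: (near hk k).
    by rewrite sub0r normrN ger0_norm ?harmonic_ge0// /harmonic/= natr1.
  have c2 : (fun k => 2 * u (q (J k)) - u (2 *: q (J k) - x)) @ \oo
      --> 2 * u x - u (2 *: x - x).
    apply: cvgB.
      by apply: cvgM; [exact: cvg_cst|exact: Conv_continuous].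
    apply: Conv_continuous => //; apply: cvgB; last exact: cvg_cst.
    by apply: mx_cvg => i j; rewrite ord1 mxE;
      under eq_cvg do rewrite mxE; apply: cvgM;
      [exact: cvg_cst|exact: coord_cvg].
  have : 2 * u x - u (2 *: x - x) > u x - e.
    by rewrite scaler_nat mulr2n addrK; lra.
  move/(cvgr_gt _ c2) => hk.
  near \oo => k; exists (J k).
  have h1 : u x - e < 2 * u (q (J k)) - u (2 *: q (J k) - x).
    exact: (near hk k).
  have := hP (q (J k)) (2 *: q (J k) - x).
  have -> : 2 *: q (J k) - x - q (J k) = q (J k) - x.
    by apply/matrixP => i j; rewrite !mxE; ring.
  rewrite evb !lformBr; lra.
exists b => x_ x xx; apply/cvgrPdist_le => e e0.
have e20 : 0 < e / 2 by lra.
have [j hj] := lb x (e / 2) e20.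
have hi : \forall k \near \oo, u (x_ k) <= u x + e.
  by have := Conv_continuous n0 xx (u := u) => /cvgr_le; apply; lra.
have lo : \forall k \near \oo, u x - e <= ev (b j) (x_ k).
  have : (fun k => ev (b j) (x_ k)) @ \oo --> ev (b j) x.
    apply: cvgD; last exact: cvg_cst.
    by apply: (@lform_cvg _ _ (fun=> _)) => // i; exact: cvg_cst.
  by move/cvgr_ge; apply; lra.
near=> k; rewrite ler_distlC; apply/andP; split.
  apply: (@le_trans _ _ (ev (b j) (x_ k))); first exact: (near lo k).
  apply: maxs_ge; rewrite inE map_f ?orbT// mem_iota /=.
  by near: k; exists j.+1.
apply: (@le_trans _ _ (u (x_ k))); last exact: (near hi k).
by rewrite maxs_le; apply/allP => c /=; rewrite inE => /predU1P[->//|/mapP[i _ ->]].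
Unshelve. all: by end_near. Qed.

End Approximation.

(** * Reduction to maxima of n + 1 affine functions *)

Section InvariantValuation.
Context (R : realType) (n : nat).
Implicit Types (u v m : Conv R n) (a b : affine R n) (W : Conv R n -> R).

(** Vanishing at affine functions is a normalization: subtracting the value at
    0 from W achieves it. *)
Record affine_SL_valuation W : Prop := AffineSLValuation {
  W_cvg : forall (u_ : nat -> Conv R n) u,
    locally_cvg u_ u -> (fun k => W (u_ k)) @ \oo --> W u;
  W_add_affine : forall u v a, (forall x, v x = u x + ev a x) -> W v = W u;
  W_SL : forall u v (psi : 'M[R]_n), \det psi = 1 ->
    (forall x, v x = u (psi *m x)) -> W v = W u;
  W_val : forall u v m, (forall x, m x = Num.min (u x) (v x)) ->
    W (Conv_max u v) + W m = W u + W v;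
  W_affine : forall a, W (Conv_affine a) = 0 }.

End InvariantValuation.

Section Reduction.
Context (R : realType) (n : nat) (W : Conv R n -> R).
Hypothesis hW : affine_SL_valuation W.
Implicit Types (u v m : Conv R n) (a b : affine R n) (J : seq (affine R n)).

Lemma Conv_maxAC u v w : Conv_max (Conv_max u v) w = Conv_max (Conv_max u w) v.
Proof. by apply: Conv_ext => x /=; rewrite maxAC. Qed.

Lemma Conv_max_l u v : (forall x, v x <= u x) -> Conv_max u v = u.
Proof. by move=> h; apply: Conv_ext => x /=; exact: max_l. Qed.

(** The alternating sum of W over the maxima of u with all subfamilies of J,
    written as an iterated difference. *)
Fixpoint Delta J u : R :=
  if J is a :: J' then Delta J' u - Delta J' (Conv_max u (Conv_affine a))
  else W u.

(** If the minimum of v and w lies below u, the valuation identity for the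
    maxima of u with v and with w survives taking the maximum with any further
    function, hence also taking iterated differences. *)
Lemma Delta_val J u v (w : Conv R n) : (forall x, Num.min (v x) (w x) <= u x) ->
  Delta J (Conv_max (Conv_max u v) w) + Delta J u =
  Delta J (Conv_max u v) + Delta J (Conv_max u w).
Proof.
elim: J u => [|a J IH] u huvw /=.
  have := @W_val _ _ _ hW (Conv_max u v) (Conv_max u w) u _.
  have -> : Conv_max (Conv_max u v) (Conv_max u w) = Conv_max (Conv_max u v) w.
    by apply: Conv_ext => x /=; rewrite maxACA maxxx maxA.
  by apply => x /=; rewrite -max_minr max_l.
rewrite !(Conv_maxAC _ _ (Conv_affine a)).
have h1 := IH u huvw.
have h2 : forall x, Num.min (v x) (w x) <= Conv_max u (Conv_affine a) x.
  by move=> x; rewrite /= le_max huvw.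
have {}h2 := IH _ h2; lra.
Qed.

(** The hypothesis says that a convex combination of the functions in wJ lies
    below u.  Split that combination as a point on the segment between the
    first function a and a convex combination r of the remaining ones.
    Delta_val applies to a and r, and the two terms containing r vanish by
    induction, since there r itself lies below the base function. *)
Lemma Delta_eq0 (wJ : seq (R * affine R n)) u :
  all (fun wa => 0 <= wa.1) wJ -> 0 < \sum_(wa <- wJ) wa.1 ->
  (forall x, \sum_(wa <- wJ) wa.1 * ev wa.2 x <= (\sum_(wa <- wJ) wa.1) * u x) ->
  Delta (map snd wJ) u = 0.
Proof.
elim: wJ u => [|[w a] wJ IH] u /=; first by rewrite big_nil ltxx.
move=> /andP[w0 wJ0]; rewrite !big_cons /=.
set S := \sum_(wa <- wJ) wa.1 => S0 hu.
have Sge0 : 0 <= S.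
  by rewrite /S big_seq sumr_ge0// => wa /(allP wJ0).
have [S00|S_neq0] := eqVneq S 0.
  rewrite Conv_max_l ?subrr// => x; have := hu x.
  rewrite big_cons /= big_seq big1 => [|wa wawJ]; last first.
    have : \sum_(i <- wJ | i \in wJ) i.1 == 0 by rewrite -big_seq -/S S00.
    rewrite psumr_eq0 => [/allP/(_ _ wawJ)|i /(allP wJ0)//].
    by rewrite wawJ /= => /eqP ->; rewrite mul0r.
  by rewrite S00 !addr0 in S0 *; rewrite ler_pM2l.
have Sgt0 : 0 < S by rewrite lt_neqAle eq_sym S_neq0.
(* the convex combination of the remaining functions *)
pose r : affine R n := (S^-1 *: \sum_(wa <- wJ) wa.1 *: wa.2.1,
                        S^-1 * \sum_(wa <- wJ) wa.1 * wa.2.2).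
have evr x : S * ev r x = \sum_(wa <- wJ) wa.1 * ev wa.2 x.
  rewrite /ev /= lformZl -mulrDr mulrA divff// mul1r.
  rewrite (big_morph (fun p => lform p x) (fun p q => lformDl p q x) (lform0l x)).
  rewrite -big_split/=.
  by apply: eq_bigr => wa _; rewrite lformZl mulrDr.
have IHr v : Delta (map snd wJ) (Conv_max v (Conv_affine r)) = 0.
  by apply: IH => // x; rewrite -evr ler_pM2l//= le_max lexx orbT.
suff hmin x : Num.min (Conv_affine a x) (Conv_affine r x) <= u x.
  have := Delta_val (map snd wJ) hmin.
  by rewrite !IHr add0r addr0 => ->; rewrite subrr.
rewrite -(ler_pM2l S0); have := hu x.
rewrite big_cons/= -evr; apply: le_trans; rewrite mulrDl.
by apply: lerD; apply: ler_wpM2l => //; rewrite ge_min lexx ?orbT.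
Qed.

(** The bound is strict because the head of maxs is not counted by size: this
    is about maxima of at most N affine functions. *)
Definition vanishes_upto N :=
  forall a (s : seq (affine R n)), (size s < N)%N -> W (maxs a s) = 0.

Lemma Delta_small N J a s : vanishes_upto N -> (size s + size J < N)%N ->
  Delta J (maxs a s) = 0.
Proof.
move=> hN; elim: J s => [|b J IH] s /=; first by rewrite addn0; exact: hN.
rewrite addnS => h; rewrite IH ?(ltnW h)//.
by rewrite (IH (b :: s)) ?subr0// addSn.
Qed.

(** All terms of the alternating sum but the last involve at most N
    functions. *)
Lemma Delta_top N J a s : vanishes_upto N -> (size s + size J <= N)%N ->
  (0 < size J)%N ->
  Delta J (maxs a s) = (-1) ^+ size J * W (maxs a (catrev J s)).
Proof.
move=> hN; case: J => // b J; elim: J s b => [|c J IH] s b /=.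
  by rewrite addn1 => h _; rewrite hN// sub0r expr1 mulN1r.
rewrite !addnS => h _; rewrite [LHS]/=.
have -> : Delta J (maxs a s) - Delta J (maxs a (c :: s)) = 0.
  by apply: (@Delta_small N (c :: J)) => //=; rewrite addnS.
rewrite sub0r; have := IH (b :: s) c; rewrite /= addSn addnS => ->//.
by rewrite [in RHS]exprS mulN1r mulNr.
Qed.

(** More than n + 1 points of an n-dimensional space are affinely dependent.
    The constants of the affine functions need not satisfy the same relation;
    replacing w by its opposite makes their defect d nonnegative. *)
Lemma affine_dependence (X : seq (affine R n)) : (n.+1 < size X)%N ->
  exists w : 'I_(size X) -> R, [/\ exists i, w i != 0, \sum_i w i = 0 &
    exists2 d : R, 0 <= d & forall x a0, \sum_i w i * ev (nth a0 X i) x = d].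
Proof.
move=> nX; set m := size X.
pose M : 'M[R]_(m, n + 1) :=
  \matrix_i row_mx (nth (0, 0) X i).1 (const_mx 1).
have kM : kermx M != 0.
  rewrite -mxrank_eq0 mxrank_ker subn_eq0 -ltnNge.
  by apply: leq_ltn_trans (rank_leq_col M) _; rewrite addn1.
have [i ri] : exists i, row i (kermx M) != 0.
  apply/existsP; apply: contraNT kM; rewrite negb_exists => /forallP h.
  apply/eqP/row_matrixP => i; rewrite row0; apply/eqP.
  by have := h i; rewrite negbK.
pose z := row i (kermx M).
have zM : z *m M = 0 by rewrite /z -row_mul mulmx_ker row0.
have sz : \sum_j z 0 j = 0.
  have /matrixP/(_ 0 (rshift n 0)) := zM; rewrite [LHS]mxE [RHS]mxE => e; rewrite -[RHS]e.
  by apply: eq_bigr => j _; rewrite [M _ _]mxE row_mxEr [const_mx _ _ _]mxE mulr1.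
have zp : \sum_j z 0 j *: (nth (0, 0) X j).1 = 0.
  apply/rowP => k; have /matrixP/(_ 0 (lshift 1 k)) := zM.
  rewrite [LHS]mxE [RHS]mxE => e; rewrite [RHS]mxE -[RHS]e.
  rewrite summxE; apply: eq_bigr => j _.
  by rewrite [LHS]mxE [M _ _]mxE row_mxEl.
pose d := \sum_j z 0 j * (nth (0, 0) X j).2.
have zev x a0 : \sum_j z 0 j * ev (nth a0 X j) x = d.
  transitivity (lform (\sum_j z 0 j *: (nth (0, 0) X j).1) x + d).
    rewrite (big_morph (fun p => lform p x) (fun p q => lformDl p q x) (lform0l x)).
    rewrite /d -big_split/=. apply: eq_bigr => j _.
    by rewrite (set_nth_default (0, 0)) // /ev lformZl mulrDr.
  by rewrite zp lform0l add0r.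
have [j zj] : exists j, z 0 j != 0.
  apply/existsP; apply: contraNT ri; rewrite negb_exists => /forallP h.
  apply/eqP/rowP => j; rewrite [RHS]mxE; apply/eqP.
  by have := h j; rewrite negbK.
have [d0|d0] := leP 0 d.
  exists (z 0); split=> //; first by exists j.
  by exists d.
exists (fun j => - z 0 j); split=> //.
- by exists j; rewrite oppr_eq0.
- by rewrite sumrN sz oppr0.
exists (- d); first by lra.
move=> x a0; rewrite -(zev x a0) -sumrN; apply: eq_bigr => k _.
by rewrite mulNr.
Qed.

(** Separate the functions by the sign of their weight in an affine
    dependence.  Nonnegativity of d says that the normalized combination of
    the functions of negative weight lies below that of the others, so
    Delta_eq0 applies with the negative ones as J. *)
Lemma vanishes_step N : (n < N)%N -> vanishes_upto N -> vanishes_upto N.+1.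
Proof.
move=> nN hN a s; rewrite ltnS leq_eqVlt => /predU1P[sN|]; last exact: hN.
pose X := a :: s.
have [|w [[i0 wi0] sw [d d0 hd]]] := @affine_dependence X.
  by rewrite /= sN ltnS.
pose P := [pred i | w i < 0].
pose nm i := nth a X (i : 'I_(size X)).
pose wJ := [seq (- w i, nm i) | i <- enum P].
pose I := [seq nm i | i <- enum [predC P]].
have sizeX : (size I + size wJ = N.+1)%N.
  by rewrite !size_map -!cardE addnC cardC card_ord /= sN.
have sumJ (f : 'I_(size X) -> R) :
    \sum_i f i = \sum_(i <- enum P) f i + \sum_(i <- enum [predC P]) f i.
  by rewrite (bigID P) !big_enum /=; congr (_ + _); apply: eq_bigl.
pose S := \sum_(wa <- wJ) wa.1.
have SE : S = \sum_(i <- enum [predC P]) w i.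
  have := sw; rewrite sumJ /S big_map/= sumrN; lra.
have [S0|S_neq0] := eqVneq S 0.
  case/eqP: wi0; have [wi|wi] := ltP (w i0) 0.
    have : \sum_(i <- enum P) - w i == 0.
      by move/eqP: S0; rewrite /S big_map.
    rewrite big_enum psumr_eq0/= => [/allP/(_ i0)|i wi']; last by rewrite /= oppr_ge0 ltW.
    by rewrite mem_index_enum inE wi /= oppr_eq0 => /(_ isT) /eqP.
  have : \sum_(i <- enum [predC P]) w i == 0 by rewrite -SE; exact/eqP.
  rewrite big_enum psumr_eq0/= => [/allP/(_ i0)|i]; last by rewrite inE -leNgt.
  by rewrite mem_index_enum inE -leNgt wi /= => /(_ isT) /eqP.
have wJ0 : all (fun wa => 0 <= wa.1) wJ.
  apply/allP => _ /mapP[i + ->] /=; rewrite mem_enum inE oppr_ge0 => /ltW//.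
have Sgt0 : 0 < S.
  rewrite lt_neqAle eq_sym S_neq0 /S big_seq sumr_ge0// => wa.
  exact: (allP wJ0).
have Imem i : (w i < 0) = false -> nm i \in I.
  by move=> wi; apply: map_f; rewrite mem_enum !inE wi.
case IE : I => [|b t].
  move: Sgt0; rewrite SE; case E : (enum _) IE => [|k l]; last by rewrite /I E.
  by rewrite big_nil ltxx.
have -> : maxs a s = maxs b (catrev (map snd wJ) t).
  apply: eq_maxs => c; rewrite [RHS]in_cons catrevE mem_cat mem_rev orbCA -in_cons -IE.
  rewrite -map_comp; apply/idP/orP => [cX|].
    have ic : (index c X < size X)%N by rewrite index_mem.
    pose i := Ordinal ic; have ci : c = nm i by rewrite /nm nth_index.
    have [wi|wi] := boolP (w i < 0).
      by left; rewrite ci; apply/mapP; exists i => //; rewrite mem_enum inE.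
    by right; rewrite ci; apply: Imem; exact: negbTE.
  by case=> /mapP[i _ ->]; rewrite /= /nm mem_nth.
have := @Delta_top N (map snd wJ) b t hN.
rewrite Delta_eq0//; last first.
  move=> x; rewrite -/S.
  apply: (@le_trans _ _ (\sum_(i <- enum [predC P]) w i * ev (nm i) x)).
    have := hd x a; rewrite sumJ big_map/=.
    under [in X in _ -> X]eq_bigr do rewrite mulNr.
    rewrite sumrN /nm; lra.
  rewrite SE mulr_suml !big_enum /=.
  apply: ler_sum => i; rewrite inE -leNgt => wi; apply: ler_wpM2l => //.
  by apply: maxs_ge; rewrite -IE; apply: Imem; rewrite ltNge wi.
move: sizeX; rewrite IE /= addSn => -[sizeX].
rewrite size_map sizeX leqnn => /(_ isT) h.
have J0 : (0 < size wJ)%N.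
  by rewrite lt0n size_eq0; apply: contraTneq Sgt0 => E; rewrite /S E big_nil ltxx.
by have /esym/eqP := h J0; rewrite mulf_eq0 signr_eq0 => /eqP.
Qed.

Lemma vanishes_all : vanishes_upto n.+1 -> forall N, vanishes_upto N.
Proof.
move=> h N a s hs; have : vanishes_upto (n.+1 + N).
  elim: N {hs} => [|N IH]; first by rewrite addn0; exact: h.
  by rewrite addnS; apply: vanishes_step; rewrite // ltn_addr.
by apply; rewrite (leq_trans hs)// leq_addl.
Qed.

Lemma vanishes_eq0 u : (0 < n)%N -> vanishes_upto n.+1 -> W u = 0.
Proof.
move=> n0 h; have [b hb] := approx_affine u n0.
have := W_cvg hW hb.
under eq_cvg => k do rewrite (@vanishes_all h _ _ _ (leqnn _)).
by move/(cvg_lim (@Rhausdorff R)) => <-; rewrite lim_cst.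
Qed.

End Reduction.

(** * Maxima over indexed families and their splitting *)

Section Families.
Context (R : realType) (n k : nat).
Implicit Types (F : 'I_k.+1 -> affine R n) (x : 'cV[R]_n).

Definition maxfam F : Conv R n := maxs (F ord0) [seq F i | i <- enum 'I_k.+1].

Lemma maxfam_ge F i x : ev (F i) x <= maxfam F x.
Proof. by apply: maxs_ge; rewrite inE map_f ?orbT// mem_enum. Qed.

Lemma maxfam_attained F x : exists i, maxfam F x = ev (F i) x.
Proof.
have [b + ->] := maxs_attained (F ord0) [seq F i | i <- enum 'I_k.+1] x.
by rewrite inE => /predU1P[->|/mapP[i _ ->]]; [exists ord0|exists i].
Qed.

Lemma maxfam_le F x (r : R) : (forall i, ev (F i) x <= r) -> maxfam F x <= r.
Proof. by move=> h; have [i ->] := maxfam_attained F x. Qed.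

Lemma maxfam_nth a (s : seq (affine R n)) : (size s <= k)%N ->
  maxs a s = maxfam (fun i => nth a (a :: s) i).
Proof.
move=> sk; apply: eq_maxs => b; rewrite [RHS]in_cons /=; apply/idP/orP.
  move=> bs; right; have ib : (index b (a :: s) < k.+1)%N.
    by rewrite ltnS; apply: leq_trans sk; rewrite -ltnS index_mem.
  apply/mapP; exists (Ordinal ib); first by rewrite mem_enum.
  by rewrite /= nth_index.
case=> [/eqP ->|/mapP[i _ ->]]; first exact: mem_head.
have [si|si] := ltnP i (size (a :: s)); first exact: mem_nth.
by rewrite nth_default// mem_head.
Qed.

Lemma maxfam_cvg (F_ : nat -> 'I_k.+1 -> affine R n) F :
  (forall (x_ : nat -> 'cV[R]_n) x i, x_ @ \oo --> x ->
     (fun l => ev (F_ l i) (x_ l)) @ \oo --> ev (F i) x) ->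
  locally_cvg (fun l => maxfam (F_ l)) (maxfam F).
Proof.
move=> hF x_ x xx; rewrite /maxfam; elim: (enum _) => [|i s IH] /=; first exact: hF.
under eq_cvg => l do rewrite maxr_absE.
rewrite maxr_absE; apply: cvgM; last exact: cvg_cst.
apply: cvgD; first by apply: cvgD => //; exact: hF.
by apply: cvg_norm; apply: cvgB => //; exact: hF.
Qed.

Definition upd (F : 'I_k.+1 -> affine R n) i g :=
  fun l => if l == i then g else F l.

Lemma upd_eq F i g : upd F i g i = g.
Proof. by rewrite /upd eqxx. Qed.

Lemma upd_neq F i g l : l != i -> upd F i g l = F l.
Proof. by rewrite /upd => /negbTE ->. Qed.

(** With g between F i and F j, the family F is covered by the two families
    obtained by replacing one end of the segment by g; maxfam_split_min
    computes the minimum of the two maxima, where both ends are replaced. *)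
Lemma maxfam_split_max F i j g (t : R) x : i != j -> 0 <= t <= 1 ->
  ev g x = (1 - t) * ev (F i) x + t * ev (F j) x ->
  maxfam F x = Num.max (maxfam (upd F j g) x) (maxfam (upd F i g) x).
Proof.
move=> ij /andP[t0 t1] gx; apply/eqP; rewrite eq_le; apply/andP; split.
  apply: maxfam_le => l; rewrite le_max; have [->|lj] := eqVneq l j.
    have := maxfam_ge (upd F i g) j x; rewrite upd_neq 1?eq_sym// => ->.
    by rewrite orbT.
  by have := maxfam_ge (upd F j g) l x; rewrite upd_neq// => ->.
have gF : ev g x <= maxfam F x.
  rewrite gx; have hi := maxfam_ge F i x; have hj := maxfam_ge F j x.
  have h1 : (1 - t) * ev (F i) x <= (1 - t) * maxfam F x by rewrite ler_wpM2l ?subr_ge0.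
  have h2 : t * ev (F j) x <= t * maxfam F x by rewrite ler_wpM2l.
  lra.
by rewrite ge_max; apply/andP; split; apply: maxfam_le => l; rewrite /upd;
  case: eqP => // _; exact: maxfam_ge.
Qed.

Lemma maxfam_split_min F i j g (t : R) x : i != j -> 0 <= t <= 1 ->
  ev g x = (1 - t) * ev (F i) x + t * ev (F j) x ->
  maxfam (upd (upd F i g) j g) x =
  Num.min (maxfam (upd F j g) x) (maxfam (upd F i g) x).
Proof.
move=> ij /andP[t0 t1] gx; apply/eqP; rewrite eq_le; apply/andP; split.
  rewrite le_min; apply/andP; split; apply: maxfam_le => l.
    have [->|lj] := eqVneq l j.
      by have := maxfam_ge (upd F j g) j x; rewrite !upd_eq.
    rewrite (upd_neq _ _ lj); have [->|li] := eqVneq l i.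
      by have := maxfam_ge (upd F j g) j x; rewrite !upd_eq.
    by have := maxfam_ge (upd F j g) l x; rewrite !upd_neq.
  have [->|lj] := eqVneq l j.
    by have := maxfam_ge (upd F i g) i x; rewrite !upd_eq.
  by rewrite (upd_neq _ _ lj); exact: maxfam_ge.
set r := maxfam (upd (upd F i g) j g) x.
have gr : ev g x <= r.
  by have := maxfam_ge (upd (upd F i g) j g) j x; rewrite upd_eq.
have Fr l : l != i -> l != j -> ev (F l) x <= r.
  by move=> li lj; have := maxfam_ge (upd (upd F i g) j g) l x; rewrite !upd_neq.
rewrite ge_min.
have [a ->] := maxfam_attained (upd F j g) x; rewrite {1}/upd.
have [_|aj] := eqVneq a j; first by rewrite gr.
have [->|ai] := eqVneq a i; last by rewrite Fr.
have [b ->] := maxfam_attained (upd F i g) x; rewrite {1}/upd.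
have [_|bi] := eqVneq b i; first by rewrite gr orbT.
have [->|bj] := eqVneq b j; last by rewrite (Fr b)// orbT.
rewrite -ge_min; apply: le_trans gr; rewrite gx.
set M := Num.min _ _.
have h1 : (1 - t) * M <= (1 - t) * ev (F i) x.
  by rewrite ler_wpM2l ?subr_ge0// ge_min lexx.
have h2 : t * M <= t * ev (F j) x by rewrite ler_wpM2l// ge_min lexx orbT.
lra.
Qed.

End Families.

Section RowData.
Context (R : realType) (n : nat) (W : Conv R n -> R).
Hypothesis hW : affine_SL_valuation W.

Definition row_affine k (P : 'M[R]_(k.+1, n)) (c : 'rV[R]_k.+1) (i : 'I_k.+1) :
  affine R n := (row i P, c 0 i).

Definition Wfam k (P : 'M[R]_(k.+1, n)) c : R := W (maxfam (row_affine P c)).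

Lemma ev_row_affine k (P : 'M[R]_(k.+1, n)) c i x :
  ev (row_affine P c i) x = (P *m x) i 0 + c 0 i.
Proof. by rewrite /ev /= /lform -row_mul mxE. Qed.

Lemma Wfam_nth a (s : seq (affine R n)) k : (size s <= k)%N ->
  exists P c, W (maxs a s) = @Wfam k P c.
Proof.
move=> sk; exists (\matrix_i (nth a (a :: s) i).1).
exists (\row_i (nth a (a :: s) i).2).
rewrite (maxfam_nth a sk) /Wfam; congr (W (maxfam _)); apply/funext => i.
by rewrite /row_affine rowK mxE -surjective_pairing.
Qed.

Lemma Wfam_cvg k (P_ : nat -> 'M[R]_(k.+1, n)) (c_ : nat -> 'rV[R]_k.+1)
    (P : 'M[R]_(k.+1, n)) (c : 'rV[R]_k.+1) :
  (forall i j, (fun l => P_ l i j) @ \oo --> P i j) ->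
  (forall i, (fun l => c_ l 0 i) @ \oo --> c 0 i) ->
  (fun l => Wfam (P_ l) (c_ l)) @ \oo --> Wfam P c.
Proof.
move=> hP hc; apply: W_cvg => //; apply: maxfam_cvg => x_ x i xx /=.
apply: cvgD; last exact: hc.
apply: (@lform_cvg _ _ (fun l => row i (P_ l))) => // j.
by rewrite mxE; under eq_cvg => l do rewrite mxE; exact: hP.
Qed.

Lemma Wfam_shift k (P : 'M[R]_(k.+1, n)) c (q : 'rV[R]_n) (d : R) :
  Wfam (P + const_mx 1 *m q) (c + const_mx d) = Wfam P c.
Proof.
apply: (W_add_affine hW (a := (q, d))) => x.
have evE i : ev (row_affine (P + const_mx 1 *m q) (c + const_mx d) i) x =
    ev (row_affine P c i) x + ev (q, d) x.
  rewrite !ev_row_affine mulmxDl -mulmxA !mxE /ev /= /lform.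
  by rewrite big_ord1 mxE mul1r; ring.
apply/eqP; rewrite eq_le; apply/andP; split.
  by apply: maxfam_le => i; rewrite evE lerD2r; exact: maxfam_ge.
by rewrite -lerBrDr; apply: maxfam_le => i; rewrite lerBrDr -evE; exact: maxfam_ge.
Qed.

Lemma Wfam_SL k (P : 'M[R]_(k.+1, n)) c (psi : 'M[R]_n) : \det psi = 1 ->
  Wfam (P *m psi) c = Wfam P c.
Proof.
move=> dpsi; apply: (W_SL hW dpsi) => x.
have evE i : ev (row_affine (P *m psi) c i) x = ev (row_affine P c i) (psi *m x).
  by rewrite !ev_row_affine mulmxA.
apply/eqP; rewrite eq_le; apply/andP; split; apply: maxfam_le => i.
  by rewrite evE; exact: maxfam_ge.
by rewrite -evE; exact: maxfam_ge.
Qed.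

Lemma Wfam_xrow k (P : 'M[R]_(k.+1, n)) c i j :
  Wfam (xrow i j P) (xcol i j c) = Wfam P c.
Proof.
congr W; apply: Conv_ext => x.
have evE l : row_affine (xrow i j P) (xcol i j c) l = row_affine P c (tperm i j l).
  by rewrite /row_affine mxE; congr (_, _); apply/rowP => a; rewrite !mxE.
apply/eqP; rewrite eq_le; apply/andP; split; apply: maxfam_le => l.
  by rewrite evE; exact: maxfam_ge.
by rewrite -(tpermK i j l) -evE; exact: maxfam_ge.
Qed.

(** With all slopes zero the maximum is a constant function. *)
Lemma Wfam_const k (c : 'rV[R]_k.+1) : Wfam 0 c = 0.
Proof.
rewrite -(W_affine hW (0, maxfam (row_affine 0 c) 0)); congr W.
apply: Conv_ext => x /=; rewrite /ev /= lform0l add0r.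
have evE l : ev (row_affine 0 c l) x = ev (row_affine 0 c l) 0.
  by rewrite !ev_row_affine !mul0mx.
apply/eqP; rewrite eq_le; apply/andP; split; apply: maxfam_le => i.
  by rewrite evE; exact: maxfam_ge.
by rewrite -evE; exact: maxfam_ge.
Qed.

Definition setrow k (P : 'M[R]_(k.+1, n)) i q : 'M[R]_(k.+1, n) :=
  \matrix_l (if l == i then q else row l P).
Definition setcol k (c : 'rV[R]_k.+1) i (d : R) : 'rV[R]_k.+1 :=
  \row_l (if l == i then d else c 0 l).

Lemma row_affine_upd k (P : 'M[R]_(k.+1, n)) c i q d :
  row_affine (setrow P i q) (setcol c i d) = upd (row_affine P c) i (q, d).
Proof.
by apply/funext => l; rewrite /row_affine /upd rowK mxE; case: eqP.
Qed.

(** The valuation property for the two families of maxfam_split_max. *)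
Lemma Wfam_split k (P : 'M[R]_(k.+1, n)) (c : 'rV[R]_k.+1) i j (t : R) :
  i != j -> 0 <= t <= 1 ->
  let q := (1 - t) *: row i P + t *: row j P in
  let d := (1 - t) * c 0 i + t * c 0 j in
  Wfam P c + Wfam (setrow (setrow P i q) j q) (setcol (setcol c i d) j d) =
  Wfam (setrow P j q) (setcol c j d) + Wfam (setrow P i q) (setcol c i d).
Proof.
move=> ij t01 q d; rewrite /Wfam !row_affine_upd.
have evq x : ev (q, d) x =
    (1 - t) * ev (row_affine P c i) x + t * ev (row_affine P c j) x.
  by rewrite /ev /= lformDl !lformZl /d; ring.
have := @W_val _ _ _ hW (maxfam (upd (row_affine P c) j (q, d)))
  (maxfam (upd (row_affine P c) i (q, d)))
  (maxfam (upd (upd (row_affine P c) i (q, d)) j (q, d)))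
  (fun x => maxfam_split_min ij t01 (evq x)).
move=> <-; congr (W _ + _).
by apply: Conv_ext => x; apply: maxfam_split_max (evq x).
Qed.

End RowData.

(** * The value depends on the slopes through a volume *)

Section Volume.
Context (R : realType) (n : nat) (W : Conv R n.+1 -> R).
Hypothesis hW : affine_SL_valuation W.
Local Notation Wfam := (Wfam W).
Local Notation "'col1'" := (const_mx 1 : 'cV[R]_n.+2).
Implicit Types (P : 'M[R]_(n.+2, n.+1)) (c : 'rV[R]_n.+2).

(** When the slopes span a proper subspace, some element of SL(n) multiplies
    all of them by t and expands a complementary direction by a power of 1 / t.
    So the value is the same for the slopes t P, and as t tends to 0 the
    function tends to a constant. *)
Lemma Wfam_rank k (P : 'M[R]_(k.+1, n.+1)) (c : 'rV[R]_k.+1) :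
  (\rank P < n.+1)%N -> Wfam P c = 0.
Proof.
move=> rP; pose B := row_ebase P.
(* the rows of P only involve the first \rank P <= n rows of B *)
pose D (t : R) : 'rV[R]_n.+1 := \row_i (if i < n then t else t ^- n)%N.
pose psi t := invmx B *m diag_mx (D t) *m B.
have Bu : B \in unitmx := row_ebase_unit P.
have dpsi t : t != 0 -> \det (psi t) = 1.
  move=> t0; rewrite !det_mulmx det_inv mulrAC mulVf; last by rewrite -unitfE -unitmxE.
  rewrite mul1r det_diag big_ord_recr /=.
  under eq_bigr => i _ do rewrite mxE /= ltn_ord.
  by rewrite prodr_const card_ord mxE /= ltnn divff// expf_neq0.
have Ppsi t : P *m psi t = t *: P.
  rewrite -[in RHS](mulmx_ebase P) -{1}(mulmx_ebase P) /psi !mulmxA.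
  rewrite -(mulmxA (_ *m pid_mx _)) mulmxV// mulmx1.
  rewrite -/B scalemxAl; congr (_ *m B); rewrite scalemxAr -mulmxA; congr (_ *m _).
  apply/matrixP => i j; rewrite mul_mx_diag !mxE mulrC; case: ltnP => // nj.
  have /negbTE -> : ~~ ((i == j :> nat) && (i < \rank P)%N); last by rewrite !mulr0.
  by apply/andP => -[/eqP ij]; rewrite ij ltnNge (leq_trans _ nj).
have Et l : Wfam ((l.+1%:R^-1 : R) *: P) c = Wfam P c.
  by rewrite -Ppsi Wfam_SL// dpsi// invr_neq0// pnatr_eq0.
have : (fun l => Wfam ((l.+1%:R^-1 : R) *: P) c) @ \oo --> Wfam 0 c.
  apply: Wfam_cvg => // [i j|i]; last exact: cvg_cst.
  under eq_cvg => l do rewrite mxE.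
  have -> : (0 : 'M[R]_(k.+1, n.+1)) i j = 0 * P i j by rewrite mxE mul0r.
  by apply: cvgM; [exact: cvg_harmonic|exact: cvg_cst].
under eq_cvg => l do rewrite Et.
move/(cvg_lim (@Rhausdorff R)); rewrite lim_cst//.
by rewrite Wfam_const.
Qed.

(** The slopes as points of an affine hyperplane of an (n + 2)-dimensional
    space, so that translations of the slopes act linearly. *)
Definition aug P : 'M[R]_(1 + n.+1) := row_mx col1 P.

(** Up to sign and the factor (n + 1)!, the volume of the simplex whose
    vertices are the rows of P. *)
Definition vol P : R := \det (aug P).

(** Affinely dependent slopes span a proper subspace after a translation,
    which amounts to adding a linear function. *)
Lemma Wfam_vol0 P c : vol P = 0 -> Wfam P c = 0.
Proof.
move=> /eqP; rewrite /vol /aug -det_tr => /det0P[v v0 vQ].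
pose z : 'rV[R]_(1 + n.+1) := v.
pose y := (rsubmx z)^T.
have Py : P *m y = const_mx (- z 0 0).
  have := congr1 trmx vQ; rewrite trmx_mul trmxK trmx0 -/z.
  rewrite -[z in z^T]hsubmxK tr_row_mx mul_row_col => /eqP.
  rewrite addrC addr_eq0 => /eqP; rewrite -/y => ->.
  apply/matrixP => i j; rewrite !mxE big_ord1 !mxE mul1r.
  by rewrite ord1; congr (- z _ _); apply/val_inj.
have [k yk] : exists k, y k 0 != 0.
  apply/existsP; apply: contraNT v0; rewrite negb_exists => /forallP h.
  have y0 : y = 0.
    by apply/colP => i; rewrite [RHS]mxE; apply/eqP; have := h i; rewrite negbK.
  have z0 : z 0 0 = 0.
    move: Py; rewrite y0 mulmx0 => /matrixP/(_ 0 0); rewrite !mxE => /eqP.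
    by rewrite eq_sym oppr_eq0 => /eqP.
  have zl : lsubmx z = 0.
    apply/rowP => i; rewrite mxE [RHS]mxE -z0 ord1.
    by congr (z 0 _); apply/val_inj.
  have zr : rsubmx z = 0 by rewrite -[LHS]trmxK -/y y0 trmx0.
  have <- : row_mx (lsubmx z) (rsubmx z) = v by exact: hsubmxK.
  by rewrite zl zr row_mx0.
pose q : 'rV[R]_n.+1 := (z 0 0 / y k 0) *: delta_mx 0 k.
have qy : q *m y = const_mx (z 0 0).
  apply/matrixP => i j; rewrite !ord1 /q -scalemxAl -rowE.
  by rewrite [LHS]mxE [row _ _ _ _]mxE [RHS]mxE divfK.
have Pqy : (P + col1 *m q) *m y = 0.
  rewrite mulmxDl Py -mulmxA qy; apply/matrixP => i j.
  by rewrite !mxE big_ord1 !mxE mul1r addNr.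
rewrite -(Wfam_shift hW P c q 0); apply: Wfam_rank.
rewrite ltn_neqAle rank_leq_col andbT; apply: contra yk => fP.
have : row_free (P + col1 *m q)^T by rewrite /row_free mxrank_tr.
move/(mulmx_free_eq0 y^T); rewrite -trmx_mul Pqy trmx0 eqxx => /esym/eqP y0.
by rewrite -[y]trmxK y0 trmx0 mxE.
Qed.

(** Two nondegenerate simplices of equal oriented volume correspond under a
    unique volume preserving affine map, vertex by vertex.  It is read off the
    matrix invmx (aug P) * aug P', whose first column is that of the
    identity. *)
Lemma Wfam_eq_vol P P' c : vol P = vol P' -> vol P != 0 -> Wfam P c = Wfam P' c.
Proof.
move=> vPP' vP0.
pose Q : 'M[R]_(1 + n.+1) := row_mx col1 P.
pose Q' : 'M[R]_(1 + n.+1) := row_mx col1 P'.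
have Qu : Q \in unitmx by rewrite unitmxE unitfE.
pose B := invmx Q *m Q'.
have QB : Q *m B = Q' by rewrite mulKVmx.
have dB : \det B = 1 by rewrite det_mulmx det_inv -[\det Q']vPP' mulVf.
have Bl : lsubmx B = col_mx 1%:M 0.
  rewrite /B -mulmx_lsub row_mxKl -(row_mxKl col1 P) mulmx_lsub mulVmx//.
  by rewrite scalar_mx_block block_mxEh row_mxKl.
have BE : B = block_mx 1%:M (usubmx (rsubmx B)) 0 (dsubmx (rsubmx B)).
  by rewrite -{1}[B]hsubmxK Bl -{1}[rsubmx B]vsubmxK block_mxEh.
have dpsi : \det (dsubmx (rsubmx B)) = 1.
  by move: dB; rewrite {1}BE det_ublock det1 mul1r.
have -> : P' = P *m dsubmx (rsubmx B) + col1 *m usubmx (rsubmx B).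
  have := congr1 rsubmx QB; rewrite row_mxKr => <-.
  by rewrite -mulmx_rsub -{1}[rsubmx B]vsubmxK mul_row_col addrC.
by rewrite -[c in RHS]addr0 (Wfam_shift hW _ _ _ 0) Wfam_SL.
Qed.

End Volume.

(** * Linearity in the volume *)

Section Cauchy.
Context (R : realType) (F : R -> R).
Hypothesis Fadd : forall x y, 0 <= x -> 0 <= y -> F (x + y) = F x + F y.
Hypothesis Fcvg : forall (x_ : nat -> R) x,
  x_ @ \oo --> x -> (fun k => F (x_ k)) @ \oo --> F x.

(** Cauchy's functional equation on the half-line. *)
Lemma additive_linear x : 0 <= x -> F x = x * F 1.
Proof.
move=> x0.
have F0 : F 0 = 0 by have := Fadd (lexx 0) (lexx 0); rewrite addr0; lra.
have Fnat (k : nat) y : 0 <= y -> F (k%:R * y) = k%:R * F y.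
  move=> y0; elim: k => [|k IH]; first by rewrite !mul0r.
  by rewrite -natr1 !mulrDl !mul1r Fadd ?mulr_ge0// IH.
(* rational approximations from below, within 1 / (k + 1) of x *)
pose q (k : nat) : R := (Num.trunc (x * k.+1%:R))%:R / k.+1%:R.
have Fq k : F (q k) = q k * F 1.
  have k0 : k.+1%:R != 0 :> R by rewrite pnatr_eq0.
  apply: (mulfI k0); rewrite -Fnat ?divr_ge0// /q.
  rewrite mulrCA divff// mulr1 mulrA [k.+1%:R * _]mulrCA divff// mulr1.
  by have := Fnat (Num.trunc (x * k.+1%:R)) 1 ler01; rewrite mulr1.
have qx : q @ \oo --> x.
  apply/cvgrPdist_le => e e0.
  have /cvgrPdist_le /(_ e e0) hk := @cvg_harmonic R.
  near=> k.
  have : `|0 - harmonic k| <= e by exact: (near hk k).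
  rewrite sub0r normrN ger0_norm ?harmonic_ge0// /harmonic/=.
  apply: le_trans; have k0 : 0 < k.+1%:R :> R by rewrite ltr0n.
  have /andP[h1 h2] := truncn_itv (mulr_ge0 x0 (ltW k0)).
  rewrite ger0_norm ?subr_ge0 ?ler_pdivrMr//.
  rewrite /q lerBlDr -{1}[k.+1%:R^-1]mul1r -mulrDl ler_pdivlMr// addrC natr1.
  exact: ltW.
have := Fcvg qx; under eq_cvg => k do rewrite Fq.
have : (fun k => q k * F 1) @ \oo --> x * F 1.
  by apply: cvgM => //; exact: cvg_cst.
by move=> /(cvg_lim (@Rhausdorff R)) <- /(cvg_lim (@Rhausdorff R)) <-.
Unshelve. all: by end_near. Qed.

End Cauchy.

Section VolumeLinear.
Context (R : realType) (n : nat) (W : Conv R n.+1 -> R).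
Hypothesis hW : affine_SL_valuation W.
Local Notation Wfam := (Wfam W).
Implicit Types (P : 'M[R]_(n.+2, n.+1)) (c : 'rV[R]_n.+2).

Lemma aug_l P i a : aug P i (lshift n.+1 a) = 1.
Proof. by rewrite /aug (@row_mxEl _ _ 1 n.+1) mxE. Qed.

Lemma aug_r P i a : aug P i (rshift 1 a) = P i a.
Proof. by rewrite /aug (@row_mxEr _ _ 1 n.+1). Qed.

Lemma vol_alternate P i j : i != j -> row i P = row j P -> vol P = 0.
Proof.
move=> ij rij; apply: (determinant_alternate (i1 := i) (i2 := j)) => // l.
case: (@split_ordP 1 n.+1 l) => a ->; first by rewrite !aug_l.
by rewrite !aug_r; have /rowP/(_ a) := rij; rewrite !mxE.
Qed.

Lemma row_setrow P i q : row i (setrow P i q) = q.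
Proof. by rewrite rowK eqxx. Qed.

Lemma row_setrow_neq P i l q : l != i -> row l (setrow P i q) = row l P.
Proof. by move=> li; rewrite rowK (negbTE li). Qed.

Lemma vol_setrow P i j (a b : R) : i != j -> a + b = 1 ->
  vol (setrow P j (a *: row i P + b *: row j P)) = b * vol P.
Proof.
move=> ij ab1; set q := _ + _.
have vol0 : vol (setrow P j (row i P)) = 0.
  by apply: (@vol_alternate _ i j) => //; rewrite row_setrow_neq// row_setrow.
rewrite /vol (determinant_multilinear (B := aug (setrow P j (row i P)))
  (C := aug P) (i0 := j) (b := a) (c := b)).
- by rewrite [\det (aug (setrow _ _ _))]vol0 mulr0 add0r.
- apply/rowP => l; rewrite [LHS]mxE [RHS]mxE ![(_ *: row _ _) _ _]mxE ![row _ _ _ _]mxE.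
  case: (@split_ordP 1 n.+1 l) => l' ->; rewrite ?aug_l ?aug_r ?mulr1//.
  by rewrite !mxE !eqxx !mxE.
- apply/matrixP => l1 l2; rewrite [LHS]mxE [RHS]mxE.
  case: (@split_ordP 1 n.+1 l2) => l' ->; rewrite ?aug_l ?aug_r ?mulr1//.
  by rewrite !mxE eq_sym (negbTE (neq_lift _ _)).
- apply/matrixP => l1 l2; rewrite [LHS]mxE [RHS]mxE.
  case: (@split_ordP 1 n.+1 l2) => l' ->; rewrite ?aug_l ?aug_r ?mulr1//.
  by rewrite !mxE eq_sym (negbTE (neq_lift _ _)) mxE.
Qed.

Lemma vol_xrow P i j : i != j -> vol (xrow i j P) = - vol P.
Proof.
move=> ij; rewrite /vol.
have -> : aug (xrow i j P) = tperm_mx i j *m aug P.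
  rewrite -xrowE; apply/matrixP => a l; rewrite [RHS]mxE.
  by case: (@split_ordP 1 n.+1 l) => l' ->; rewrite ?aug_l ?aug_r ?mxE.
by rewrite det_mulmx det_perm odd_tperm ij expr1 mulN1r.
Qed.

(** The simplex with vertices 0, V e_1, e_2, ..., a representative of the
    simplices of oriented volume V. *)
Definition std_simplex (V : R) : 'M[R]_(n.+2, n.+1) :=
  col_mx (0 : 'M[R]_(1, n.+1)) (diag_mx (\row_i (if i == 0 then V else 1))).

Lemma std_simplex_l V (a : 'I_1) j : std_simplex V (lshift n.+1 a : 'I_(1 + n.+1)) j = 0.
Proof. by rewrite /std_simplex (@col_mxEu _ 1 n.+1) mxE. Qed.

Lemma std_simplex_r V a j :
  std_simplex V (rshift 1 a : 'I_(1 + n.+1)) j = (if a == 0 then V else 1) *+ (a == j).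
Proof. by rewrite /std_simplex (@col_mxEd _ 1 n.+1) !mxE. Qed.

Lemma vol_std_simplex V : vol (std_simplex V) = V.
Proof.
pose D : 'rV[R]_n.+1 := \row_i (if i == 0 then V else 1).
have augE : aug (std_simplex V) =
    block_mx (1%:M : 'M[R]_1) 0 (const_mx 1 : 'cV[R]_n.+1) (diag_mx D).
  rewrite block_mxEh /aug; congr row_mx; apply/colP => i; rewrite mxE.
  case: (@split_ordP 1 n.+1 i) => l ->; first by rewrite col_mxEu mxE ord1.
  by rewrite col_mxEd mxE.
rewrite /vol augE det_lblock det1 mul1r det_diag.
by rewrite big_ord_recl mxE eqxx big1 ?mulr1// => i _; rewrite mxE.
Qed.

Lemma Wfam_std P c : Wfam P c = Wfam (std_simplex (vol P)) c.
Proof.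
have [P0|P0] := eqVneq (vol P) 0; last first.
  by apply: (Wfam_eq_vol hW); rewrite ?vol_std_simplex.
by rewrite !(Wfam_vol0 hW) ?vol_std_simplex.
Qed.

(** Cutting a simplex by the hyperplane through a point of the edge ij and the
    remaining vertices divides its volume in the ratio of the point.  The
    common face is degenerate and contributes nothing. *)
Lemma Wfam_split_simplex P c i j (t : R) : i != j -> 0 <= t <= 1 ->
  let d := (1 - t) * c 0 i + t * c 0 j in
  Wfam P c = Wfam (std_simplex (t * vol P)) (setcol c j d) +
          Wfam (std_simplex ((1 - t) * vol P)) (setcol c i d).
Proof.
move=> ij t01 d; pose q := (1 - t) *: row i P + t *: row j P.
have both0 : vol (setrow (setrow P i q) j q) = 0.
  by apply: (@vol_alternate _ i j) => //; rewrite row_setrow_neq// !row_setrow.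
have := Wfam_split hW P c ij t01; rewrite -/d -/q /= (Wfam_vol0 hW _ both0) addr0.
have vj : vol (setrow P j q) = t * vol P by rewrite vol_setrow// subrK.
have vi : vol (setrow P i q) = (1 - t) * vol P.
  by rewrite /q addrC vol_setrow 1?eq_sym// addrC subrK.
by move=> ->; rewrite [in LHS]Wfam_std vj [Wfam (setrow P i q) _]Wfam_std vi.
Qed.

Lemma setcol_id c i d : c 0 i = d -> setcol c i d = c.
Proof. by move=> <-; apply/rowP => l; rewrite mxE; case: eqP => // ->. Qed.

Lemma Wfam_std_cvg c (V_ : nat -> R) V : V_ @ \oo --> V ->
  (fun k => Wfam (std_simplex (V_ k)) c) @ \oo --> Wfam (std_simplex V) c.
Proof.
move=> VV; apply: Wfam_cvg => // [i j|i]; last exact: cvg_cst.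
case: (@split_ordP 1 n.+1 i) => l ->.
  by under eq_cvg => k do rewrite std_simplex_l; rewrite std_simplex_l; exact: cvg_cst.
under eq_cvg => k do rewrite std_simplex_r.
rewrite std_simplex_r; case: (l == j); last by rewrite mulr0n; exact: cvg_cst.
by rewrite mulr1n; case: (l == 0) => //=; exact: cvg_cst.
Qed.

(** When the constants at i and j agree, splitting the edge ij leaves c
    unchanged, so the value is additive in the volume.  Exchanging the
    rows i and j reverses orientation without changing the function, hence
    the absolute value. *)
Lemma Wfam_repeated P c i j : i != j -> c 0 i = c 0 j ->
  Wfam P c = `|vol P| * Wfam (std_simplex 1) c.
Proof.
move=> ij cij.
have pos V : 0 <= V -> Wfam (std_simplex V) c = V * Wfam (std_simplex 1) c.
  apply: (@additive_linear R (fun V => Wfam (std_simplex V) c)) => [x y x0 y0|x_ x].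
    have [xy0|xy0] := eqVneq (x + y) 0.
      have -> : x = 0 by lra.
      have -> : y = 0 by lra.
      by rewrite addr0 (Wfam_vol0 hW) ?vol_std_simplex// addr0.
    have t01 : 0 <= x / (x + y) <= 1.
      have ? : 0 < x + y by rewrite lt_neqAle eq_sym xy0 addr_ge0.
      by rewrite divr_ge0 ?addr_ge0//= ler_pdivrMr// mul1r lerDl.
    rewrite (Wfam_split_simplex (std_simplex (x + y)) c ij t01) vol_std_simplex.
    rewrite -cij -mulrDl subrK mul1r !setcol_id//.
    by congr (Wfam (std_simplex _) c + Wfam (std_simplex _) c); field.
  exact: Wfam_std_cvg.
have [V0|V0] := leP 0 (vol P); first by rewrite Wfam_std pos// ger0_norm.
have -> : Wfam P c = Wfam (xrow i j P) c.
  rewrite -(Wfam_xrow W P c i j); congr Wfam; apply/rowP => l; rewrite mxE.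
  by case: tpermP => [->|->|].
by rewrite Wfam_std vol_xrow// pos ?oppr_ge0 ?ltW// ltr0_norm.
Qed.

(** This needs three indices, that is dimension at least 2. *)
Lemma between3 c : (0 < n)%N -> exists i j l (t : R),
  [/\ i != j, l != i, l != j, 0 <= t <= 1 & c 0 l = (1 - t) * c 0 i + t * c 0 j].
Proof.
move=> n0.
have key i j l : i != j -> l != i -> l != j -> c 0 i <= c 0 l <= c 0 j ->
    exists i j l (t : R), [/\ i != j, l != i, l != j, 0 <= t <= 1 &
      c 0 l = (1 - t) * c 0 i + t * c 0 j].
  move=> ij li lj /andP[h1 h2]; exists i, j, l.
  have [e|ne] := eqVneq (c 0 i) (c 0 j).
    by exists 0; split=> //; rewrite ?lexx ?ler01//; lra.
  have pos : 0 < c 0 j - c 0 i.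
    by rewrite subr_gt0 lt_neqAle ne (le_trans h1).
  exists ((c 0 l - c 0 i) / (c 0 j - c 0 i)); split=> //.
    apply/andP; split; first by rewrite divr_ge0 ?subr_ge0// (le_trans h1).
    by rewrite ler_pdivrMr// mul1r lerD2r.
  by field; lra.
have h1 : (1 < n.+2)%N by []. have h2 : (2 < n.+2)%N by rewrite !ltnS.
pose a : 'I_n.+2 := ord0; pose b := Ordinal h1; pose d := Ordinal h2.
have [ab ad bd] : [/\ a != b, a != d & b != d] by [].
have [cab|/ltW cab] := leP (c 0 a) (c 0 b).
  have [cbd|/ltW cbd] := leP (c 0 b) (c 0 d).
    by apply: (key a d b); rewrite 1?eq_sym// cab.
  have [cad|/ltW cad] := leP (c 0 a) (c 0 d).
    by apply: (key a b d); rewrite // 1?eq_sym// cad.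
  by apply: (key d b a); rewrite 1?eq_sym// cad.
have [cad|/ltW cad] := leP (c 0 a) (c 0 d).
  by apply: (key b d a); rewrite // cab.
have [cbd|/ltW cbd] := leP (c 0 b) (c 0 d).
  by apply: (key b a d); rewrite 1?eq_sym// cbd.
by apply: (key d a b); rewrite 1?eq_sym// cbd.
Qed.

(** Split the edge ij at the point where the value of c is c l: both pieces
    have a repeated constant. *)
Lemma Wfam_linear P c : (0 < n)%N -> Wfam P c = `|vol P| * Wfam (std_simplex 1) c.
Proof.
move=> n0; have [i [j [l [t [ij li lj t01 cl]]]]] := between3 c n0.
have ci V : Wfam (std_simplex V) (setcol c i (c 0 l)) =
    `|V| * Wfam (std_simplex 1) (setcol c i (c 0 l)).
  by rewrite (@Wfam_repeated _ _ i l) 1?eq_sym ?vol_std_simplex// !mxE eqxx (negbTE li).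
have cj V : Wfam (std_simplex V) (setcol c j (c 0 l)) =
    `|V| * Wfam (std_simplex 1) (setcol c j (c 0 l)).
  by rewrite (@Wfam_repeated _ _ j l) 1?eq_sym ?vol_std_simplex// !mxE eqxx (negbTE lj).
rewrite !(Wfam_split_simplex _ c ij t01) -cl ci cj [in RHS]ci [in RHS]cj.
rewrite vol_std_simplex.
by rewrite !normrM normr1; ring.
Qed.

End VolumeLinear.

(** * The density is constant and vanishes *)

Section MaximumPrinciple.
Context (R : realType) (n : nat).
Implicit Types (c : 'rV[R]_n.+1).

Lemma seq_continuous (f : 'rV[R]_n.+1 -> R) :
  (forall (c_ : nat -> 'rV[R]_n.+1) c, c_ @ \oo --> c ->
     (fun k => f (c_ k)) @ \oo --> f c) -> continuous f.
Proof.
move=> hf c; apply/(@cvgrPdist_lt _ _ _ _ (nbhs_filter c)) => e e0.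
apply/nbhs_ballP; apply: contrapT => hn.
have /choice[y hy] : forall k : nat, exists y : 'rV[R]_n.+1,
    ball c (k.+1%:R^-1 : R) y /\ ~ (`|f c - f y| < e).
  move=> k; apply: contrapT => /forallNP hk; apply: hn.
  exists k.+1%:R^-1 => /=; first by rewrite invr_gt0.
  by move=> z bz; apply: contrapT => hz; apply: (hk z).
have yc : y @ \oo --> c.
  apply/cvg_ballP => d d0.
  have /cvgrPdist_lt /(_ d d0) hk := @cvg_harmonic R.
  near=> k; apply: le_ball (hy k).1; apply: ltW.
  have : `|0 - harmonic k| < d by exact: (near hk k).
  by rewrite sub0r normrN ger0_norm ?harmonic_ge0.
have /cvgrPdist_lt /(_ e e0) hk := hf _ _ yc.
near \oo => k; apply: (hy k).2; exact: (near hk k).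
Unshelve. all: by end_near. Qed.

Context (g : 'rV[R]_n.+1 -> R).
Hypothesis gcvg : forall (c_ : nat -> 'rV[R]_n.+1) c,
  (forall i, (fun k => c_ k 0 i) @ \oo --> c 0 i) ->
  (fun k => g (c_ k)) @ \oo --> g c.
Hypothesis gshift : forall c (d : R), g (c + const_mx d) = g c.
Hypothesis gsplit : forall c i j (t : R), i != j -> 0 <= t <= 1 ->
  let d := (1 - t) * c 0 i + t * c 0 j in
  g c = t * g (setcol c j d) + (1 - t) * g (setcol c i d).

(** At a maximum point c over the cube, splitting writes g c as an average of
    two values of g over the cube.  The one at setcol c j (d k) has the
    positive weight t k, so it is maximal too; as t k tends to 0, its entry
    d k tends to c 0 0. *)
Lemma contract_max (L : R) c j :
  let box b := forall i, 0 <= (b : 'rV[R]_n.+1) 0 i <= L in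
  box c -> (forall b, box b -> g b <= g c) ->
  box (setcol c j (c 0 0)) /\ g (setcol c j (c 0 0)) = g c.
Proof.
move=> box bc hc; split; first by move=> i; rewrite mxE; case: eqP => _; exact: bc.
have [->|j0] := eqVneq j 0.
  by congr g; apply/rowP => i; rewrite mxE; case: eqP => // ->.
pose t (k : nat) : R := k.+1%:R^-1.
pose d k := (1 - t k) * c 0 0 + t k * c 0 j.
have t0 k : 0 < t k by rewrite invr_gt0.
have t1 k : t k <= 1 by rewrite invf_le1 ?ltr0n// ler1n.
have bd i k : box (setcol c i (d k)).
  move=> l; rewrite mxE; case: eqP => // _.
  have /andP[a1 a2] := bc 0; have /andP[b1 b2] := bc j.
  have ht := t1 k; have ht0 := ltW (t0 k).
  apply/andP; split; first by rewrite addr_ge0 ?mulr_ge0 ?subr_ge0.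
  have h1 : (1 - t k) * c 0 0 <= (1 - t k) * L by rewrite ler_wpM2l ?subr_ge0.
  have h2 : t k * c 0 j <= t k * L by rewrite ler_wpM2l.
  rewrite /d; lra.
have gd k : g (setcol c j (d k)) = g c.
  have := @gsplit c 0 j (t k); rewrite eq_sym j0 (ltW (t0 k)) t1.
  move=> /(_ isT isT) /=; rewrite -/(d k) => e.
  apply/eqP; rewrite eq_le hc//=; rewrite -(ler_pM2l (t0 k)).
  have h : (1 - t k) * g (setcol c 0 (d k)) <= (1 - t k) * g c.
    by rewrite ler_wpM2l ?subr_ge0// hc.
  move: e h; lra.
have : (fun k => g (setcol c j (d k))) @ \oo --> g (setcol c j (c 0 0)).
  apply: gcvg => i; under eq_cvg => k do rewrite mxE.
  rewrite mxE; case: (i == j); last exact: cvg_cst.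
  have -> : c 0 0 = (1 - 0) * c 0 0 + 0 * c 0 j by rewrite subr0 mul1r mul0r addr0.
  apply: cvgD; apply: cvgM; try exact: cvg_cst.
    by apply: cvgB; [exact: cvg_cst|exact: cvg_harmonic].
  exact: cvg_harmonic.
under eq_cvg => k do rewrite gd.
by move=> /(cvg_lim (@Rhausdorff R)); rewrite lim_cst.
Qed.

(** Move c into a cube by adding a constant, take a maximum point of g over
    the cube, and contract its entries one after the other to the first. *)
Lemma le_at_const c : g c <= g 0.
Proof.
(* adding B to every entry moves c into the cube of side 2 B *)
pose B := \sum_i `|c 0 i|.
have cB i : `|c 0 i| <= B.
  by rewrite /B (bigD1 i)//= lerDl sumr_ge0.
pose box (b : 'rV[R]_n.+1) := forall i, 0 <= b 0 i <= 2 * B.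
have boxc : box (c + const_mx B).
  move=> i; rewrite !mxE; have := cB i; rewrite ler_norml => /andP[h1 h2].
  by apply/andP; split; lra.
have cg : continuous g.
  apply: seq_continuous => c_ b cb; apply: gcvg => i.
  exact: (continuous_cvg _ (@coord_continuous R 1 n.+1 0 i b)).
have [|||b] := @EVT_max_rV R n.+1 g [set b | box b].
- by exists (c + const_mx B).
- by apply: (@rV_compact R n.+1 (fun=> `[0, 2 * B]%classic)) => i; exact: segment_compact.
- exact: continuous_subspaceT.
rewrite inE /= => boxb maxb.
have {}maxb a : box a -> g a <= g b by move=> ba; apply: maxb; rewrite inE.
rewrite -(gshift c B); apply: le_trans (maxb _ boxc) _.
have [a [boxa ga a0 al]] : exists a, [/\ box a, g a = g b, a 0 0 = b 0 0 &
    forall j, j \in enum 'I_n.+1 -> a 0 j = b 0 0].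
  elim: (enum _) => [|j s [a [boxa ga a0 al]]]; first by exists b.
  have maxa e : box e -> g e <= g a by rewrite ga; exact: maxb.
  have [boxa' ga'] := @contract_max (2 * B) a j boxa maxa.
  exists (setcol a j (a 0 0)); split=> //.
  - by rewrite ga' ga.
  - by rewrite mxE; case: ifP.
  - by move=> i; rewrite inE mxE; case: eqP => //= _ /al.
rewrite -ga -(gshift 0 (b 0 0)) add0r.
have -> : a = const_mx (b 0 0).
  by apply/rowP => j; rewrite al ?mem_enum// mxE.
by [].
Qed.

End MaximumPrinciple.

Section SimplexVanish.
Context (R : realType) (n : nat) (W : Conv R n.+1 -> R).
Hypothesis hW : affine_SL_valuation W.
Hypothesis n0 : (0 < n)%N.
Implicit Types (c : 'rV[R]_n.+2).

(** The value of W per unit of volume of the simplex of slopes, as a function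
    of the constants. *)
Definition density c : R := Wfam W (std_simplex n 1) c.

Lemma density_split c i j (t : R) : i != j -> 0 <= t <= 1 ->
  let d := (1 - t) * c 0 i + t * c 0 j in
  density c = t * density (setcol c j d) + (1 - t) * density (setcol c i d).
Proof.
move=> ij /[dup] t01 /andP[t0 t1] d; rewrite /density.
rewrite (Wfam_split_simplex hW _ _ ij t01) -/d vol_std_simplex !mulr1.
rewrite [in LHS](Wfam_linear hW) // vol_std_simplex ger0_norm//; congr (_ + _).
by rewrite (Wfam_linear hW) // vol_std_simplex ger0_norm// subr_ge0.
Qed.

(** The maximum principle applied to the density and to its opposite. *)
Lemma density_const c : density c = density 0.
Proof.
have dcvg (c_ : nat -> 'rV[R]_n.+2) (b : 'rV[R]_n.+2) :
    (forall i, (fun k => c_ k 0 i) @ \oo --> b 0 i) ->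
    (fun k => density (c_ k)) @ \oo --> density b.
  by move=> h; apply: Wfam_cvg => // i j; exact: cvg_cst.
have dshift b (d : R) : density (b + const_mx d) = density b.
  have := Wfam_shift hW (std_simplex n 1) b 0 d.
  by rewrite mulmx0 addr0.
apply/eqP; rewrite eq_le; apply/andP; split.
  by apply: (le_at_const dcvg dshift) => b i j t; exact: density_split.
rewrite -lerN2; apply: (@le_at_const R n.+1 (fun b => - density b)).
- by move=> c_ b h; apply: cvgN; exact: dcvg.
- by move=> b d; rewrite dshift.
- by move=> b i j t ij t01 d; rewrite (density_split b ij t01) -/d; ring.
Qed.

(** Lowering the last constant to - k makes the last affine function
    negligible on bounded sets, so the maxima converge to a maximum of n + 1
    functions, which has a degenerate simplex of slopes. *)
Lemma density0 : density 0 = 0.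
Proof.
pose P : 'M[R]_(n.+2, n.+1) := std_simplex n 1.
pose P' := setrow P ord_max (row ord0 P).
pose c_ (k : nat) : 'rV[R]_n.+2 := setcol 0 ord_max (- k%:R).
have <- : Wfam W P' 0 = 0.
  apply: (Wfam_vol0 hW); apply: (@vol_alternate _ _ _ ord0 ord_max) => //.
  by rewrite row_setrow_neq// row_setrow.
have : (fun k => W (maxfam (row_affine P (c_ k)))) @ \oo --> Wfam W P' 0.
  apply: (W_cvg hW) => x_ x xx.
  have cv : (fun k => maxfam (row_affine P' 0) (x_ k)) @ \oo -->
      maxfam (row_affine P' 0) x.
    exact: Conv_continuous.
  have cl : (fun k => lform (row ord_max P) (x_ k)) @ \oo --> lform (row ord_max P) x.
    by apply: (@lform_cvg _ _ (fun=> _)) => // i; exact: cvg_cst.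
  apply: cvg_trans (cv); apply: near_eq_cvg.
  (* beyond K the last function lies below the others along x_ *)
  pose K := lform (row ord_max P) x + 1 - (maxfam (row_affine P' 0) x - 1).
  have N1 : \forall k \near \oo,
      lform (row ord_max P) (x_ k) <= lform (row ord_max P) x + 1.
    by move/cvgr_le : cl; apply; lra.
  have N2 : \forall k \near \oo,
      maxfam (row_affine P' 0) x - 1 <= maxfam (row_affine P' 0) (x_ k).
    by move/cvgr_ge : cv; apply; lra.
  have N3 : \forall k \near \oo, K <= k%:R by exact: nbhs_infty_ger.
  near=> k.
  have hk : lform (row ord_max P) (x_ k) - k%:R <= maxfam (row_affine P' 0) (x_ k).
    have h1 : lform (row ord_max P) (x_ k) <= lform (row ord_max P) x + 1.
      exact: (near N1 k).
    have h2 : maxfam (row_affine P' 0) x - 1 <= maxfam (row_affine P' 0) (x_ k).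
      exact: (near N2 k).
    have h3 : K <= k%:R by exact: (near N3 k).
    by move: h3; rewrite /K; lra.
  have evlast : ev (row_affine P (c_ k) ord_max) (x_ k) =
      lform (row ord_max P) (x_ k) - k%:R.
    by rewrite /ev /= mxE eqxx.
  have evother i : i != ord_max ->
      ev (row_affine P (c_ k) i) (x_ k) = ev (row_affine P' 0 i) (x_ k).
    by move=> im; rewrite /ev /= row_setrow_neq// !mxE (negbTE im).
  apply/eqP; rewrite eq_le; apply/andP; split; apply: maxfam_le => i.
    have [->|im] := eqVneq i ord_max; last by rewrite -evother//; exact: maxfam_ge.
    have -> : ev (row_affine P' 0 ord_max) (x_ k) = ev (row_affine P' 0 ord0) (x_ k).
      by rewrite /ev /= row_setrow row_setrow_neq// !mxE.
    by rewrite -evother//; exact: maxfam_ge.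
  have [->|im] := eqVneq i ord_max; last by rewrite evother//; exact: maxfam_ge.
  by rewrite evlast.
under eq_cvg => k do rewrite [W _](density_const (c_ k)).
by move=> /(cvg_lim (@Rhausdorff R)); rewrite lim_cst.
Unshelve. all: by end_near. Qed.

Lemma simplex_vanish : vanishes_upto W n.+2.
Proof.
move=> a s; rewrite ltnS => sn; have [P [c ->]] := Wfam_nth W a sn.
by rewrite (Wfam_linear hW)// -/(density c) density_const density0 mulr0.
Qed.

End SimplexVanish.

(** * From an operator to a real valuation *)

Section Main.
Context (R : realType) (n : nat).
Implicit Types (u v : Conv R n) (Z : Conv R n -> 'cV[R]_n -> R).

(** Adding the linear function with slope e, conjugated by the translation
    along d e, adds an extra constant d: this is how constants, which the
    hypotheses do not mention, are reached. *)
Lemma translation_const Z : (0 < n)%N -> translation_homomorphism Z ->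
  forall u v p (d : R), (forall x, v x = u x + ev (p, d) x) ->
  Z v 0 = Z u 0 + d.
Proof.
move=> n0 tZ u v p d vu; pose i0 := Ordinal n0.
pose e : 'cV[R]_n := delta_mx i0 0.
(* w x = u x + e x + d *)
pose w := Conv_translate (- d *: e) (Conv_add_ell e (Conv_translate (d *: e) u)).
have ee : ell e e = 1 :> R.
  rewrite /ell /dot (bigD1 i0)//= big1 => [|i ii0]; last first.
    by rewrite !mxE eqxx andbT (negbTE ii0) mul0r.
  by rewrite !mxE !eqxx mul1r addr0.
have ellZ (r : R) : ell e (r *: e) = r.
  rewrite -[RHS]mulr1 -ee /ell /dot mulr_sumr; apply: eq_bigr => i _.
  by rewrite !mxE mulrA.
have wE x : w x = u x + lform e^T x + d.
  rewrite /w /= /translate scaleNr opprK /= addrK -addrA; congr (_ + _).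
  by rewrite -ellE trmxK -{2}(ellZ d) /ell /dot -big_split/=;
     apply: eq_bigr => i _; rewrite !mxE mulrDl.
have vE : v = Conv_add_ell (p^T - e) w.
  apply: Conv_ext => x; rewrite vu.
  transitivity (w x + ell (p^T - e) x); last by [].
  rewrite wE /ev /=.
  have -> : ell (p^T - e) x = lform p x - lform e^T x.
    by rewrite -!ellE trmxK /ell /dot -sumrB; apply: eq_bigr => i _;
       rewrite !mxE mulrBr.
  by ring.
have ell0 (y : 'cV[R]_n) : ell y 0 = 0 :> R.
  by rewrite /ell /dot big1// => i _; rewrite mxE mul0r.
rewrite vE (tZ w _).2 /= ell0 addr0 /w (tZ _ _).1 /translate sub0r.
rewrite (tZ _ e).2 /= (tZ u _).1 /translate scaleNr opprK subrr.
by rewrite ellZ.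
Qed.

Lemma difference_valuation Z : (0 < n)%N ->
  epi_continuous Z -> SL_covariant Z -> is_valuation Z ->
  translation_homomorphism Z ->
  forall u0, u0 =1 cst 0 ->
  affine_SL_valuation (fun u => Z u 0 - u 0 - (Z u0 0)).
Proof.
move=> n0 cZ sZ vZ tZ u0 u00; split.
- move=> u_ u cu; apply: cvgB; last exact: cvg_cst.
  apply: cvgB; first exact/cZ/locally_cvg_epi.
  exact: (cu (fun=> 0) 0 (cvg_cst _)).
- move=> u v [p d] vu; rewrite (translation_const n0 tZ vu) vu /ev /= lform0r.
  by ring.
- move=> u v psi dpsi vu.
  have psiu : psi \in unitmx by rewrite unitmxE dpsi unitr1.
  have -> : v = Conv_precomp (invmx (invmx psi)) u.
    by apply: Conv_ext => x; rewrite vu /= /precomp invmxK.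
  by rewrite sZ ?det_inv ?dpsi ?invr1// /precomp /= /precomp mulmx0.
- move=> u v m mE.
  have := vZ u v (Conv_max u v) m erefl (funext mE).
  move/(congr1 (fun f => f 0)) => /= h.
  have : (u \max v) 0 + m 0 = u 0 + v 0 by rewrite mE /= addr_max_min.
  by rewrite /=; move: h; lra.
- move=> [p d]; rewrite (@translation_const _ n0 tZ u0 _ p d) => [|x].
    by rewrite /= /ev /= lform0r; ring.
  by rewrite u00 add0r.
Qed.

End Main.

Theorem theorem6p1 (R : realType) (n : nat) (hn : (3 <= n)%N)
    (Z : Conv R n -> ('cV[R]_n -> R)) :
  [/\ epi_continuous Z, SL_covariant Z, is_valuation Z
    & translation_homomorphism Z] <->
  exists c : R, forall u : Conv R n, Z u = (fun x => u x + c).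
Proof.
have n0 : (0 < n)%N by exact: leq_trans hn.
split=> [[cZ sZ vZ tZ]|[c hZ]]; last first.
  split.
  - move=> u_ u eu x; rewrite hZ; under eq_cvg => k do rewrite hZ.
    by apply: cvgD; [exact: epi_cvg_pointwise|exact: cvg_cst].
  - by move=> u phi _; rewrite !hZ.
  - move=> u v w m wE mE; rewrite !hZ; apply/funext => x /=.
    by rewrite wE mE /=; have := addr_max_min (u x) (v x); lra.
  - move=> u y; rewrite !hZ; split; apply/funext => x //=.
    by rewrite addrAC.
have [u0 u00] : exists u0 : Conv R n, u0 =1 cst 0.
  by exists (Conv_affine (0, 0)) => x; rewrite /= /ev lform0l addr0.
have hW := difference_valuation n0 cZ sZ vZ tZ u00.
exists (Z u0 0) => u; apply/funext => x.
pose v := Conv_translate (- x) u.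
have vx : v 0 = u x by rewrite /= /translate opprK add0r.
have Zv : Z v 0 = Z u x by rewrite (tZ u _).1 /translate opprK add0r.
rewrite -vx -Zv; apply/eqP; rewrite -subr_eq0 opprD addrA; apply/eqP.
(* v = u (x + _), so the goal is the vanishing of W at v *)
case: n hn n0 Z cZ sZ vZ tZ u0 u00 hW u x v vx Zv => // n hn n0 Z cZ sZ vZ tZ
  u0 u00 hW u x v _ _.
by apply: (vanishes_eq0 hW) => //; apply: (simplex_vanish hW); exact: ltnW.
Qed.
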